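(* Suppose the standing assumptions (1)–(5) listed in the context hold and, additionally, that the true nulls are evenly distributed: $\pi_{g,0}=\pi_0$ for all $1\le g\le G$. Then $$\lim_{m\to\infty}\mathrm{FDR}(\mathrm{IHW})=\pi_0\alpha,$$ and for any sequence (indexed by $m\ge1$) of random weight functions $\widehat W$ such that $\widehat W:[0,1]\to\widehat K_{\mathrm{NE}}$ and $\widehat G_{\widehat W}$ is nondecreasing, $$\lim_{m\to\infty}\mathrm{Pow}(\mathrm{IHW})\ \ge\ \limsup_{m\to\infty}\mathrm{Pow}\big(\mathrm{MWBH}(\widehat W)\big).$$
   Context: Setting. Fix an integer $G\ge2$. For each $m$ one tests $m$ null hypotheses split into $G$ groups of sizes $m_1,\dots,m_G$ (nondecreasing integer sequences depending on $m$, $\sum_g m_g=m$). In group $g$, $H_{g,1},\dots,H_{g,m_g}\in\{0,1\}$ are fixed ($H_{g,i}=0$: the null is true), and the $p$-values $p_{g,1},\dots,p_{g,m_g}$ are $[0,1]$-valued random variables. Let $m_{g,1}=\sum_i H_{g,i}$, $m_{g,0}=m_g-m_{g,1}$, and $U(x)=\mathbf 1\{x>0\}\min(x,1)$. All limits are as $m\to\infty$. Standing assumptions: (1) if $H_{g,i}=0$, $p_{g,i}$ is uniform on $[0,1]$; (2) if $H_{g,i}=1$, $p_{g,i}$ has c.d.f. $F_g$ (not depending on $i$ or $m$), strictly concave on $[0,1]$, with $F_g(0)=0$; (3) there are $\pi_g>0$, $\pi_{g,0}>0$ with $m_g/m\to\pi_g$, $m_{g,0}/m_g\to\pi_{g,0}$,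 and $\pi_{g,1}=1-\pi_{g,0}>0$, for each $g$; (4) weak dependence: for each $g$ and $t\ge0$, in probability, $\frac1{m_{g,0}}\sum_{i}\mathbf 1\{p_{g,i}\le t,H_{g,i}=0\}\to U(t)$ and $\frac1{m_{g,1}}\sum_{i}\mathbf 1\{p_{g,i}\le t,H_{g,i}=1\}\to F_g(t)$ (no assumption on dependence across groups); (5) the target level satisfies $\alpha\in(\alpha^*,1)$, where $$\alpha^*=\inf_{w\in K^\infty}\frac1{\sum_g\pi_gw_g(\pi_{g,0}+\pi_{g,1}f_g(0^+))},\qquad K^\infty=\Big\{w\in\mathbb R_+^G:\sum_g\pi_gw_g\le1\Big\},$$ $f_g(0^+)=\lim_{x\to0^+}(F_g(x)-F_g(0))/x\in[0,\infty]$ (conventions $1/\infty=0$, $1/0=\infty$, $0\cdot\infty=0$). Put $\pi_0=\sum_g\pi_g\pi_{g,0}$. Procedures. For nondecreasing $h:[0,1]\to[0,1]$ with $h(0)=0$, $\mathcal I(h)=\sup\{u\in[0,1]:h(u)\ge u\}$. For a (possibly random) weight function $W:[0,1]\to\mathbb R_+^G$ (a vector $w$ is viewed as a constant function), $$\widehat G_W(u)=m^{-1}\sum_{g=1}^G\sum_{i=1}^{m_g}\mathbf 1\{p_{g,i}\le\alpha uW_g(u)\}.$$ If $\widehat G_W$ is nondecreasing, let $\hat u_W=\mathcal I(\widehat G_W)$ and $\mathrm{MWBH}(W)=\{(g,i):p_{g,i}\le\alpha\hat u_WW_g(\hat u_W)\}$ (set of rejected indices). Let $\widehat K_{\mathrm{NE}}=\{w\in\mathbb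 R_+^G:\sum_g\frac{m_g}mw_g\le1\}$. Fix any random function $\widehat W^*_{\mathrm{NE}}:[0,1]\to\widehat K_{\mathrm{NE}}$ with $\widehat G_{\widehat W^*_{\mathrm{NE}}}(u)=\max_{w\in\widehat K_{\mathrm{NE}}}\widehat G_w(u)$ for all $u\in[0,1]$ (such a maximum exists, $\widehat G_{\widehat W^*_{\mathrm{NE}}}$ is nondecreasing; random functions are understood to be such that the quantities considered are measurable). $\mathrm{IHW}=\mathrm{MWBH}(\widehat W^*_{\mathrm{NE}})$. Criteria. For a procedure $R$ (random set of rejected indices), with $\mathcal H_j=\{(g,i):H_{g,i}=j\}$, $\mathrm{FDR}(R)=\mathbb E\big[|R\cap\mathcal H_0|/(|R|\vee1)\big]$ and $\mathrm{Pow}(R)=m^{-1}\mathbb E\big[|R\cap\mathcal H_1|\big]$. *)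

(* Defs.v *)
From HB Require Import structures.
From mathcomp Require Import all_boot all_order all_algebra.
From mathcomp Require Import all_classical all_reals all_analysis.

Set Implicit Arguments.
Unset Strict Implicit.
Unset Printing Implicit Defensive.

Import Order.TTheory GRing.Theory Num.Theory.
Import numFieldNormedType.Exports.

Local Open Scope classical_set_scope.
Local Open Scope ring_scope.

Section multiple_testing.
Context {R : realType} {G : nat}.

(* An element of [hyp n] is a pair (g, i) with i < n g. *)
Definition hyp (n : 'I_G -> nat) : finType := {g : 'I_G & 'I_(n g)}.

Definition num_alt (n : 'I_G -> nat) (H : forall g, 'I_(n g) -> bool)
  (g : 'I_G) : nat := (\sum_(i < n g) H g i)%N.

Definition num_null (n : 'I_G -> nat) (H : forall g, 'I_(n g) -> bool)
  (g : 'I_G) : nat := (n g - num_alt H g)%N.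

Definition nulls (n : 'I_G -> nat) (H : forall g, 'I_(n g) -> bool) :
  {set hyp n} := finset (fun k : hyp n => ~~ H (tag k) (tagged k)).

Definition alts (n : 'I_G -> nat) (H : forall g, 'I_(n g) -> bool) :
  {set hyp n} := finset (fun k : hyp n => H (tag k) (tagged k)).

Definition U (x : R) : R := (0 < x)%R%:R * Num.min x 1.

Definition strictly_concave01 (F : R -> R) : Prop :=
  forall x y t : R, 0 <= x <= 1 -> 0 <= y <= 1 -> x != y -> 0 < t < 1 ->
    t * F x + (1 - t) * F y < F (t * x + (1 - t) * y).

(* The probability spaces may vary with the index; the limit is constant. *)
Definition cvg_in_prob (d : nat -> measure_display)
    (T : forall m, measurableType (d m)) (P : forall m, probability (T m) R)
    (X : forall m, T m -> R) (l : R) : Prop :=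
  forall e : R, 0 < e ->
    P m [set x | e < `|X m x - l|] @[m --> \oo] --> 0%E.

Definition emp_null (n : 'I_G -> nat) (H : forall g, 'I_(n g) -> bool)
    (p : forall g, 'I_(n g) -> R) (g : 'I_G) (t : R) : R :=
  (num_null H g)%:R^-1 * \sum_(i < n g) ((p g i <= t)%R && ~~ H g i)%:R.

Definition emp_alt (n : 'I_G -> nat) (H : forall g, 'I_(n g) -> bool)
    (p : forall g, 'I_(n g) -> R) (g : 'I_G) (t : R) : R :=
  (num_alt H g)%:R^-1 * \sum_(i < n g) ((p g i <= t)%R && H g i)%:R.

Definition slope0 (F : R -> R) : \bar R :=
  lim (((F x - F 0) / x)%:E @[x --> 0^'+]).

Definition Kinf (pi : 'I_G -> R) : set ('I_G -> R) :=
  [set w | (forall g, 0 <= w g) /\ \sum_g pi g * w g <= 1].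

(* The extended reals of the library satisfy 0 * +oo = 0, +oo^-1 = 0 and
   0^-1 = +oo. *)
Definition alpha_star (pi pi0 : 'I_G -> R) (F : 'I_G -> R -> R) : \bar R :=
  ereal_inf [set ((\sum_(g < G) (pi g * w g)%:E *
    ((pi0 g)%:E + (1 - pi0 g)%:E * slope0 (F g)))^-1)%E | w in Kinf pi].

Definition KNE (m : nat) (n : 'I_G -> nat) : set ('I_G -> R) :=
  [set w | (forall g, 0 <= w g) /\ \sum_g (n g)%:R / m%:R * w g <= 1].

Definition crossing (h : R -> R) : R :=
  sup [set u | 0 <= u <= 1 /\ u <= h u].

(* Below, [p] is a realization of the p-values and [W] one of the weight
   function, of which only the restriction to [0,1] matters. *)
Definition Ghat (m : nat) (n : 'I_G -> nat) (alpha : R)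
    (p : forall g, 'I_(n g) -> R) (W : R -> 'I_G -> R) (u : R) : R :=
  m%:R^-1 * \sum_g \sum_(i < n g) (p g i <= alpha * u * W u g)%R%:R.

Definition uhat (m : nat) (n : 'I_G -> nat) (alpha : R)
    (p : forall g, 'I_(n g) -> R) (W : R -> 'I_G -> R) : R :=
  crossing (Ghat m alpha p W).

Definition MWBH (m : nat) (n : 'I_G -> nat) (alpha : R)
    (p : forall g, 'I_(n g) -> R) (W : R -> 'I_G -> R) : {set hyp n} :=
  finset (fun k : hyp n => p (tag k) (tagged k) <=
    alpha * uhat m alpha p W * W (uhat m alpha p W) (tag k)).

Definition KNE_valued (m : nat) (n : 'I_G -> nat) (W : R -> 'I_G -> R) : Prop :=
  forall u, 0 <= u <= 1 -> KNE m n (W u).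

Definition Ghat_nondecreasing (m : nat) (n : 'I_G -> nat) (alpha : R)
    (p : forall g, 'I_(n g) -> R) (W : R -> 'I_G -> R) : Prop :=
  forall u v, 0 <= u -> u <= v -> v <= 1 ->
    Ghat m alpha p W u <= Ghat m alpha p W v.

Definition Ghat_optimal (m : nat) (n : 'I_G -> nat) (alpha : R)
    (p : forall g, 'I_(n g) -> R) (W : R -> 'I_G -> R) : Prop :=
  forall u, 0 <= u <= 1 -> forall w, KNE m n w ->
    Ghat m alpha p (fun=> w) u <= Ghat m alpha p W u.

Definition random_set (n : 'I_G -> nat) d (T : measurableType d)
    (S : T -> {set hyp n}) : Prop :=
  forall k : hyp n, measurable [set x : T | k \in S x].

Definition FDR (n : 'I_G -> nat) (H : forall g, 'I_(n g) -> bool)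
    d (T : measurableType d) (P : probability T R) (S : T -> {set hyp n}) :
    \bar R :=
  'E_P[fun x => #|S x :&: nulls H|%:R / (maxn #|S x| 1)%:R].

Definition Pow (m : nat) (n : 'I_G -> nat) (H : forall g, 'I_(n g) -> bool)
    d (T : measurableType d) (P : probability T R) (S : T -> {set hyp n}) :
    \bar R :=
  ((m%:R^-1)%:E * 'E_P[fun x => #|S x :&: alts H|%:R])%E.

End multiple_testing.

(* Main.v *)
Require Import Defs.
From HB Require Import structures.
From mathcomp Require Import all_boot all_order all_algebra.
From mathcomp Require Import all_classical all_reals all_analysis.
From mathcomp Require Import measurable_realfun ring lra.

Set Implicit Arguments.
Unset Strict Implicit.
Unset Printing Implicit Defensive.

Import Order.TTheory GRing.Theory Num.Theory.
Import numFieldNormedType.Exports.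

Local Open Scope classical_set_scope.
Local Open Scope ring_scope.

(* With the thresholds t_g = alpha u w_g as unknowns, the limiting rejection
   fraction at the best weights is the concave function M(s) = sup of
   sum_g pi_g D_g(t_g) under the budget sum_g pi_g t_g <= s, taken at
   s = alpha u, where D_g(t) = q t + (1 - q) F_g(t) and q = pi_0 is the common
   null proportion.  By concavity and alpha > alpha_star, u |-> M(alpha u) - u
   crosses 0 transversally at a unique us > 0, so that the empirical crossing
   point of IHW is close to us once the empirical c.d.f.s are uniformly close
   to their limits.
   Since D_g has slope at least q > 0, M grows at rate at least q: near-optimal
   thresholds nearly exhaust the budget alpha us.  Hence the fraction of null
   rejections tends to q alpha us, that of all rejections to us, and the FDR
   to q alpha, with no need for the optimal weights to be unique.  As M(s) - q s
   is nondecreasing, thresholds of cost at most alpha us cannot give more than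
   M(alpha us) - q alpha us = (1 - q alpha) us alternative rejections, and
   the crossing point of any other weight function is at most that of IHW,
   up to errors that vanish in the limit. *)

(** * The limiting allocation problem *)

Definition concave01 {R : realType} (f : R -> R) : Prop :=
  forall x y t, 0 <= x <= 1 -> 0 <= y <= 1 -> 0 <= t <= 1 ->
    t * f x + (1 - t) * f y <= f (t * x + (1 - t) * y).

(** A common interface for [U] and the [F g], hence concavity without strictness. [ccv_rc0] is right
    continuity at 0, the only point of [0,1] where a nondecreasing concave function can jump. *)
Record concave_cdf {R : realType} (f : R -> R) : Prop := ConcaveCdf {
  ccv_nd : forall x y, x <= y -> f x <= f y;
  ccv_0 : f 0 = 0;
  ccv_1 : forall x, 1 <= x -> f x = 1;
  ccv_concave : concave01 f;
  ccv_rc0 : forall e, 0 < e -> exists2 x, 0 < x <= 1 & f x <= e }.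

Lemma concave_cdf_ge0 {R : realType} (f : R -> R) x :
  concave_cdf f -> 0 <= x -> 0 <= f x.
Proof. by move=> fP x0; rewrite -fP.(ccv_0); exact: fP.(ccv_nd). Qed.

Lemma concave_cdf_le1 {R : realType} (f : R -> R) x : concave_cdf f -> f x <= 1.
Proof.
move=> fP; case: (leP x 1) => [x1|/ltW x1]; last by rewrite fP.(ccv_1).
by rewrite -(fP.(ccv_1) (lexx 1)); exact: fP.(ccv_nd).
Qed.

(** A concave graph that lies [c] above the diagonal at [x] and meets it at [y] falls below it past
    [y] at rate at least [c / (y - x)], and [y - x <= 1]. *)
Lemma secant_right {R : realType} (x y z c v : R) : 0 < x -> x < y -> y < z ->
    z <= 1 -> 0 < c ->
  (z - y) * (x + c) + (y - x) * v <= (z - x) * y -> v <= z - c * (z - y).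
Proof.
move=> x0 xy yz z1 c0 h.
rewrite -(@ler_pM2l _ (y - x)); last lra.
have : 0 <= c * (z - y) * (1 - (y - x)) by rewrite !mulr_ge0//; lra.
lra.
Qed.

Lemma secant_left {R : realType} (x y z c v : R) : 0 < x -> x < y -> y < z ->
    z <= 1 -> 0 < c ->
  (z - y) * (x + c) + (y - x) * z <= (z - x) * v -> y + c * (z - y) <= v.
Proof.
move=> x0 xy yz z1 c0 h.
rewrite -(@ler_pM2l _ (z - x)); last lra.
have : 0 <= c * (z - y) * (1 - (z - x)) by rewrite !mulr_ge0//; lra.
lra.
Qed.

Section limit_problem.
Context {R : realType} {G : nat}.
Variables (pi : 'I_G -> R) (F : 'I_G -> R -> R) (q : R).
Hypothesis pi_gt0 : forall g, 0 < pi g.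
Hypothesis pi_sum1 : \sum_g pi g = 1.
Hypothesis q01 : 0 < q < 1.
Hypothesis F_ccdf : forall g, concave_cdf (F g).

Implicit Types (t : 'I_G -> R) (s : R).

(** [mix g] and [value] are the functions [D_g] and [M] of the overview. As p-values never exceed 1,
    thresholds are confined to [0,1]; [value] is a supremum, so that no maximizer has to be
    exhibited. *)
Definition mix (g : 'I_G) (x : R) : R := q * x + (1 - q) * F g x.
Definition reward t : R := \sum_g pi g * mix g (t g).
Definition cost t : R := \sum_g pi g * t g.
Definition affordable s : set ('I_G -> R) :=
  [set t | (forall g, 0 <= t g <= 1) /\ cost t <= s].
Definition value s : R := sup (reward @` affordable s).

Lemma mix_le1 g x : x <= 1 -> mix g x <= 1.
Proof.
rewrite /mix; move/andP: q01 => [q0 q1] x1.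
have := concave_cdf_le1 x (F_ccdf g); nra.
Qed.

Lemma reward_le1 t : (forall g, t g <= 1) -> reward t <= 1.
Proof.
move=> t1; rewrite -pi_sum1; apply: ler_sum => g _.
by rewrite ger_pMr// mix_le1.
Qed.

Lemma reward0 : reward (fun=> 0) = 0.
Proof.
apply: big1 => g _; rewrite /mix (ccv_0 (F_ccdf g)).
by rewrite !mulr0 addr0 mulr0.
Qed.

Lemma affordable0 s : 0 <= s -> affordable s (fun=> 0).
Proof.
move=> s0; split=> [g|]; first by rewrite lexx ler01.
by rewrite /cost big1// => g _; rewrite mulr0.
Qed.

Lemma reward_le_value s t : affordable s t -> reward t <= value s.
Proof.
move=> st; apply: ub_le_sup; last by exists t.
by exists 1 => _ [t' [t'01 _] <-]; apply: reward_le1 => g; case/andP: (t'01 g).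
Qed.

Lemma value_le s x : 0 <= s ->
  (forall t, affordable s t -> reward t <= x) -> value s <= x.
Proof.
move=> s0 sx; apply: ge_sup.
  by exists (reward (fun=> 0)), (fun=> 0) => //; exact: affordable0.
by move=> _ [t st <-]; exact: sx.
Qed.

Lemma value_ge0 s : 0 <= s -> 0 <= value s.
Proof. by move=> s0; rewrite -reward0; apply/reward_le_value/affordable0. Qed.

Lemma value_le1 s : 0 <= s -> value s <= 1.
Proof.
move=> s0; apply: value_le => // t [t01 _]; apply: reward_le1 => g.
by case/andP: (t01 g).
Qed.

Lemma reward_concave t1 t2 a : (forall g, 0 <= t1 g <= 1) ->
  (forall g, 0 <= t2 g <= 1) -> 0 <= a <= 1 ->
  a * reward t1 + (1 - a) * reward t2
  <= reward (fun g => a * t1 g + (1 - a) * t2 g).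
Proof.
move=> t1P t2P a01; rewrite /reward !mulr_sumr -big_split /=.
apply: ler_sum => g _; rewrite !(mulrCA _ (pi g)) -mulrDr ler_pM2l// /mix.
have := ccv_concave (F_ccdf g) (t1P g) (t2P g) a01.
move/andP: q01 => [q0 q1]; nra.
Qed.

Lemma affordable_convex s1 s2 t1 t2 a : affordable s1 t1 -> affordable s2 t2 ->
  0 <= a <= 1 ->
  affordable (a * s1 + (1 - a) * s2) (fun g => a * t1 g + (1 - a) * t2 g).
Proof.
move=> [t1P t1s] [t2P t2s] /andP[a0 a1]; split=> [g|].
  move: (t1P g) (t2P g) => /andP[? ?] /andP[? ?]; nra.
rewrite /cost (eq_bigr (fun g => a * (pi g * t1 g) + (1 - a) * (pi g * t2 g))).
  rewrite big_split -!mulr_sumr /= lerD// ler_wpM2l//; lra.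
by move=> g _; ring.
Qed.

Lemma value_concave s1 s2 a : 0 <= s1 -> 0 <= s2 -> 0 < a < 1 ->
  a * value s1 + (1 - a) * value s2 <= value (a * s1 + (1 - a) * s2).
Proof.
move=> s10 s20 /andP[a0 a1]; set V := value (_ + _).
have a'0 : 0 < 1 - a by lra.
(* The two suprema are bounded one after the other, so that no near-maximizers have to be chosen. *)
suff: value s1 <= (V - (1 - a) * value s2) / a by rewrite ler_pdivlMr//; lra.
apply: value_le => // t1 t1P; rewrite ler_pdivlMr//.
suff: value s2 <= (V - a * reward t1) / (1 - a) by rewrite ler_pdivlMr//; lra.
apply: value_le => // t2 t2P; rewrite ler_pdivlMr//.
have a01 : 0 <= a <= 1 by lra.
have := reward_le_value (affordable_convex t1P t2P a01).
have := reward_concave t1P.1 t2P.1 a01.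
rewrite -/V; lra.
Qed.

Lemma value_chord s1 s2 s3 : 0 <= s1 -> s1 < s2 -> s2 < s3 ->
  (s3 - s2) * value s1 + (s2 - s1) * value s3 <= (s3 - s1) * value s2.
Proof.
move=> s10 s12 s23.
have d0 : 0 < s3 - s1 by lra.
have a01 : 0 < (s3 - s2) / (s3 - s1) < 1.
  by apply/andP; split; [apply: divr_gt0|rewrite ltr_pdivrMr]; lra.
have s30 : 0 <= s3 by lra.
have := value_concave s10 s30 a01.
have -> : 1 - (s3 - s2) / (s3 - s1) = (s2 - s1) / (s3 - s1) by field; lra.
have -> : (s3 - s2) / (s3 - s1) * s1 + (s2 - s1) / (s3 - s1) * s3 = s2.
  by field; lra.
rewrite -(ler_pM2l d0); congr (_ <= _); field; lra.
Qed.

Lemma value_nd s1 s2 : 0 <= s1 -> s1 <= s2 -> value s1 <= value s2.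
Proof.
move=> s10 s12; apply: value_le => // t [tP ts].
by apply: reward_le_value; split=> //; exact: le_trans s12.
Qed.

(** Concavity against the point 0, where [value] is nonnegative: the ratio [value s / s] is
    nonincreasing. *)
Lemma value_star s1 s2 : 0 < s1 -> s1 <= s2 -> s1 * value s2 <= s2 * value s1.
Proof.
move=> s10; rewrite le_eqVlt => /predU1P[->//|s12].
have s20 : 0 < s2 by exact: lt_trans s12.
have a01 : 0 < s1 / s2 < 1 by rewrite divr_gt0//= ltr_pdivrMr// mul1r.
have := value_concave (ltW s20) (lexx 0) a01.
rewrite mulr0 addr0 divfK ?gt_eqF//.
have : 0 <= (1 - s1 / s2) * value 0.
  by rewrite mulr_ge0 ?value_ge0//; lra.
move=> h1 h2; have : s1 / s2 * value s2 <= value s1 by lra.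
by rewrite mulrAC ler_pdivrMr// (mulrC (value s1)).
Qed.

(* Moving the thresholds towards 1 buys at least [q] per unit of cost. *)
Lemma value_slope s1 s2 : 0 <= s1 -> s1 <= s2 -> s2 <= 1 ->
  value s1 + q * (s2 - s1) <= value s2.
Proof.
move=> s10; rewrite le_eqVlt => /predU1P[-> _|s12 s21].
  by rewrite subrr mulr0 addr0.
rewrite -lerBrDr; apply: value_le => // t [tP ts].
have cost_lt : cost t < 1 by lra.
(* Moving every threshold by the fraction [l] of its distance to 1 brings the cost to exactly [s2],
   since the [pi g] sum to 1. *)
set l := (s2 - cost t) / (1 - cost t).
have d0 : 0 < 1 - cost t by lra.
have l0 : 0 <= l by rewrite divr_ge0//; lra.
have l1 : l <= 1 by rewrite ler_pdivrMr//; lra.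
have ld : l * (1 - cost t) = s2 - cost t by rewrite divfK// gt_eqF.
set t' := fun g => (1 - l) * t g + l.
have t'P : affordable s2 t'.
  split=> [g|]; first by rewrite /t'; move: (tP g) => /andP[? ?]; nra.
  rewrite /cost (eq_bigr (fun g => (1 - l) * (pi g * t g) + l * pi g)).
    by rewrite big_split -!mulr_sumr /= -/(cost t) pi_sum1; lra.
  by move=> g _; rewrite /t'; ring.
have := reward_le_value t'P.
suff : reward t + q * (s2 - cost t) <= reward t'.
  by move: q01 => /andP[? ?]; nra.
rewrite -ld mulrBr -pi_sum1 /cost !mulr_sumr -sumrB mulr_sumr -big_split /=.
apply: ler_sum => g _.
have -> : pi g * mix g (t g) + q * (l * pi g - l * (pi g * t g)) =
  pi g * (mix g (t g) + q * (l * (1 - t g))) by ring.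
rewrite ler_pM2l// /mix /t'.
(* The alternative part does not decrease, and the null part gains [q l (1 - t g)]. *)
have : F g (t g) <= F g ((1 - l) * t g + l).
  by apply: ccv_nd => //; move: (tP g) => /andP[? ?]; nra.
by move: q01 => /andP[? ?]; nra.
Qed.

(** By [value_star] the increment is at most [(s2 - s1) value s1 / s1], and [value] is at most 1. *)
Lemma value_lipschitz s0 s1 s2 : 0 < s0 -> s0 <= s1 -> s1 <= s2 ->
  value s2 <= value s1 + (s2 - s1) / s0.
Proof.
move=> s00 s01 s12.
have s10 : 0 < s1 by lra.
have v1 := value_le1 (ltW s10).
have := value_star s10 s12.
have : (s2 - s1) / s1 <= (s2 - s1) / s0.
  by rewrite ler_wpM2l ?subr_ge0// lef_pV2 ?posrE.
suff : s1 * value s2 <= s2 * value s1 -> value s2 <= value s1 + (s2 - s1) / s1.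
  by lra.
move=> h; rewrite -(ler_pM2l s10) mulrDr mulrCA divff ?gt_eqF// mulr1.
have : (s2 - s1) * value s1 <= s2 - s1 by rewrite ler_piMr// subr_ge0.
lra.
Qed.

Lemma value_le_line s : 0 <= s <= 1 -> value s <= 1 - q * (1 - s).
Proof.
move=> /andP[s0 s1].
have := value_slope s0 s1 (lexx 1); have := value_le1 ler01; lra.
Qed.

Variables (alpha u0 : R).
Hypothesis alpha01 : 0 < alpha < 1.
Hypothesis u01 : 0 < u0 <= 1.
Hypothesis u0_value : u0 < value (alpha * u0).

Lemma value_crossing : exists us c : R,
  [/\ 0 < c, u0 < us < 1, value (alpha * us) = us,
    forall u : R, us <= u <= 1 -> value (alpha * u) <= u - c * (u - us) &
    forall u : R, u0 <= u <= us -> u + c * (us - u) <= value (alpha * u)].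
Proof.
have [a0 a1] := andP alpha01; have [u00 u0le1] := andP u01.
have [q0 q1] := andP q01.
pose A := [set u | 0 <= u <= 1 /\ u <= value (alpha * u)].
have Au0 : A u0 by split; [lra|exact: ltW].
have ubA : ubound A 1 by move=> u [/andP[]].
have supA : has_sup A by split; [exists u0 | exists 1].
pose us : R := sup A.
have u0us : u0 <= us by apply: ub_le_sup => //; exists 1.
have us1 : us <= 1 by apply: ge_sup; [exists u0|].
have value_ltr u : us < u -> u <= 1 -> value (alpha * u) < u.
  move=> usu u1; rewrite ltNge; apply/negP => h.
  have : u <= us by apply: ub_le_sup; [exists 1|split=> //; lra].
  lra.
(* Otherwise some [u] above [1 - q (1 - alpha)] would satisfy [u <= value (alpha u)], which
   [value_le_line] bounds by [1 - q (1 - alpha)]. *)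
have us_lt1 : us < 1.
  rewrite ltNge; apply/negP => us1'.
  have [|u [/andP[u_0 u_1] uv]] := @sup_adherent R A (q * (1 - alpha)) _ supA.
    by rewrite mulr_gt0//; lra.
  rewrite -/us => hu.
  have au1 : alpha * u <= alpha by rewrite ger_pMr//.
  have au0 : 0 <= alpha * u by rewrite mulr_ge0// ltW.
  have : 0 <= alpha * u <= 1 by lra.
  move=> /value_le_line.
  have : q * alpha * u <= q * alpha by rewrite ger_pMr// mulr_gt0.
  lra.
(* Monotonicity of [value] stands in for continuity: [us] is compared with points of [A] just below
   it, then with points outside [A] just above it. *)
have ge_us : us <= value (alpha * us).
  apply/ler_addgt0Pr => e e0.
  have [u [/andP[u_0 u_1] uv]] := sup_adherent e0 supA; rewrite -/us => hu.
  have uus : u <= us by apply: ub_le_sup; [exists 1|split=> //; lra].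
  have : value (alpha * u) <= value (alpha * us) by apply: value_nd; nra.
  lra.
have le_us : value (alpha * us) <= us.
  apply/ler_addgt0Pr => e e0.
  pose u := Num.min (us + e) 1.
  have [h1 h2 h3] : [/\ us < u, u <= 1 & u <= us + e].
    by rewrite /u; case: (leP (us + e) 1) => ?; split; lra.
  have := value_ltr _ h1 h2.
  have : value (alpha * us) <= value (alpha * u) by apply: value_nd; nra.
  lra.
have val_us : value (alpha * us) = us by apply/eqP; rewrite eq_le le_us.
have u0_lt : u0 < us.
  rewrite lt_neqAle u0us andbT; apply/eqP => h; move: u0_value.
  by rewrite h val_us ltxx.
pose c : R := value (alpha * u0) - u0.
have c0 : 0 < c by rewrite subr_gt0.
have cE : value (alpha * u0) = u0 + c by rewrite /c; lra.
have chord u v : u0 <= u -> u < v -> forall w, v < w ->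
    (w - v) * value (alpha * u) + (v - u) * value (alpha * w)
    <= (w - u) * value (alpha * v).
  move=> u0u uv w vw; have := @value_chord (alpha * u) (alpha * v) (alpha * w).
  rewrite -!mulrBr -!mulrA -mulrDr !ler_pM2l// !ltr_pM2l//.
  by apply=> //; nra.
exists us, c; split => //; first by rewrite u0_lt.
- move=> u /andP[]; rewrite le_eqVlt => /predU1P[<- _|usu u1].
    by rewrite subrr mulr0 subr0 val_us.
  have := chord _ _ (lexx u0) u0_lt _ usu; rewrite val_us cE.
  move: (value (alpha * u)) => V; exact: secant_right.
- move=> u /andP[]; rewrite le_eqVlt => /predU1P[<- _|u0u].
    rewrite cE; have : c * (us - u0) <= c by rewrite ger_pMr//; lra.
    lra.
  rewrite le_eqVlt => /predU1P[->|uus]; first by rewrite subrr mulr0 addr0 val_us.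
  have := chord _ _ (lexx u0) u0u _ uus; rewrite val_us cE.
  move: (value (alpha * u)) => V; exact: secant_left.
Qed.

End limit_problem.

(** * The empirical allocation problem *)

Section empirical_problem.
Context {R : realType} {G : nat}.
Variables (pi : 'I_G -> R) (F : 'I_G -> R -> R) (q : R).
Hypothesis pi_gt0 : forall g, 0 < pi g.
Hypothesis pi_sum1 : \sum_g pi g = 1.
Hypothesis q01 : 0 < q < 1.
Hypothesis F_ccdf : forall g, concave_cdf (F g).

Local Notation value := (value pi F q).
Local Notation reward := (reward pi F q).
Local Notation cost := (cost pi).

(* [a g] stands for [m_g / m], and [N0 g x], [N1 g x] for [1 / m] times the
   numbers of null and alternative p-values of group [g] that are [<= x]. *)
Record uclose (e : R) (a : 'I_G -> R) (N0 N1 : 'I_G -> R -> R) : Prop := UClose {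
  close_a : forall g, `|a g - pi g| <= e;
  close_N0 : forall g x, 0 <= x <= 1 -> `|N0 g x - pi g * (q * x)| <= e;
  close_N1 : forall g x, 0 <= x <= 1 ->
    `|N1 g x - pi g * ((1 - q) * F g x)| <= e;
  close_a_ge0 : forall g, 0 <= a g;
  close_N0_ge0 : forall g x, 0 <= N0 g x;
  close_N1_ge0 : forall g x, 0 <= N1 g x;
  close_N0_min1 : forall g x, N0 g (Num.min x 1) = N0 g x;
  close_N1_min1 : forall g x, N1 g (Num.min x 1) = N1 g x }.

Section fixed_error.
Variables (e : R) (a : 'I_G -> R) (N0 N1 : 'I_G -> R -> R).
Hypothesis e0 : 0 <= e.
Hypothesis closeP : uclose e a N0 N1.

Implicit Types (t : 'I_G -> R).

Definition Ntot (N : 'I_G -> R -> R) t : R := \sum_g N g (t g).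
(** Truncating at 1 leaves the counts unchanged and brings thresholds into [0,1], where [uclose]
    gives its estimates. *)
Definition trunc t : 'I_G -> R := fun g => Num.min (t g) 1.
Definition err : R := G%:R * e.

Let err0 : 0 <= err. Proof. by rewrite mulr_ge0. Qed.

Lemma trunc01 t : (forall g, 0 <= t g) -> forall g, 0 <= trunc t g <= 1.
Proof. by move=> t0 g; rewrite /trunc le_min t0 ler01 ge_min lexx orbT. Qed.

Lemma errE : err = \sum_(g < G) e.
Proof. by rewrite sumr_const card_ord /err mulr_natl. Qed.

Lemma cost_trunc t b : (forall g, 0 <= t g) -> \sum_g a g * t g <= b ->
  cost (trunc t) <= b + err.
Proof.
move=> t0 tb; apply: (@le_trans _ _ (\sum_g a g * t g + err)); last by rewrite lerD2r.
rewrite errE -big_split /=; apply: ler_sum => g _.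
have /andP[h0 h1] := trunc01 t0 g.
have ht : trunc t g <= t g by rewrite ge_min lexx.
have := closeP.(close_a) g; rewrite ler_distl => /andP[h2 h3].
have : a g * trunc t g <= a g * t g.
  by rewrite ler_wpM2l// closeP.(close_a_ge0).
have : (pi g - a g) * trunc t g <= e.
  apply: (@le_trans _ _ (e * trunc t g)); first by rewrite ler_wpM2r//; lra.
  by rewrite ler_piMr.
lra.
Qed.

Lemma Ntot0_close t : (forall g, 0 <= t g) ->
  `|Ntot N0 t - q * cost (trunc t)| <= err.
Proof.
move=> t0; rewrite /Ntot /cost mulr_sumr -sumrB.
apply: le_trans (ler_norm_sum _ _ _) _; rewrite errE; apply: ler_sum => g _.
rewrite -closeP.(close_N0_min1) mulrCA.
exact: (closeP.(close_N0) g (trunc01 t0 g)).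
Qed.

Lemma Ntot1_close t : (forall g, 0 <= t g) ->
  `|Ntot N1 t - (reward (trunc t) - q * cost (trunc t))| <= err.
Proof.
move=> t0; rewrite /Ntot /reward /cost mulr_sumr -!sumrB.
apply: le_trans (ler_norm_sum _ _ _) _; rewrite errE; apply: ler_sum => g _.
rewrite -closeP.(close_N1_min1).
have -> : pi g * mix F q g (trunc t g) - q * (pi g * trunc t g) =
  pi g * ((1 - q) * F g (trunc t g)) by rewrite /mix; ring.
exact: (closeP.(close_N1) g (trunc01 t0 g)).
Qed.

Variables (alpha u0 us c : R).
Hypothesis alpha01 : 0 < alpha < 1.
Hypothesis u00 : 0 < u0.
Hypothesis us_lt : u0 < us < 1.
Hypothesis c0 : 0 < c.
Hypothesis value_us : value (alpha * us) = us.
Hypothesis value_right : forall u : R, us <= u <= 1 ->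
  value (alpha * u) <= u - c * (u - us).
Hypothesis value_left : forall u : R, u0 <= u <= us ->
  u + c * (us - u) <= value (alpha * u).

Definition thresholds (W : R -> 'I_G -> R) (u : R) : 'I_G -> R :=
  fun g => alpha * u * W u g.
Definition Gemp (W : R -> 'I_G -> R) (u : R) : R :=
  Ntot N0 (thresholds W u) + Ntot N1 (thresholds W u).
Definition feasible : set ('I_G -> R) :=
  [set w | (forall g, 0 <= w g) /\ \sum_g a g * w g <= 1].
Definition feasible_valued (W : R -> 'I_G -> R) : Prop :=
  forall u, 0 <= u <= 1 -> feasible (W u).
Definition optimal (W : R -> 'I_G -> R) : Prop :=
  forall u, 0 <= u <= 1 -> forall w, feasible w -> Gemp (fun=> w) u <= Gemp W u.

(** The distance from [Gemp] to [value (alpha u)]: one [err] each for the null and the alternative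
    counts, and the effect on [value] of a budget misjudged by [err]. *)
Definition err1 : R := 2 * err + err / (alpha * u0).
(** A vertical error [err1] displaces a crossing of slope [c] horizontally by at most this much. *)
Definition err2 : R := err1 / c.

Let a0 : 0 < alpha. Proof. by case/andP: alpha01. Qed.
Let a1 : alpha < 1. Proof. by case/andP: alpha01. Qed.
Let q0 : 0 < q. Proof. by case/andP: q01. Qed.
Let q1 : q < 1. Proof. by case/andP: q01. Qed.
Let us1 : us < 1. Proof. by case/andP: us_lt. Qed.
Let u0us : u0 < us. Proof. by case/andP: us_lt. Qed.
Let us0 : 0 < us. Proof. exact: lt_trans u0us. Qed.
Let au0 : 0 < alpha * u0. Proof. exact: mulr_gt0. Qed.
Let erra : 0 <= err / (alpha * u0).
Proof. by rewrite divr_ge0// ltW. Qed.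
Let err10 : 0 <= err1. Proof. by rewrite addr_ge0// mulr_ge0. Qed.
Let err20 : 0 <= err2. Proof. by rewrite divr_ge0// ltW. Qed.

Lemma thresholds_ge0 W u : feasible_valued W -> 0 <= u <= 1 ->
  forall g, 0 <= thresholds W u g.
Proof.
move=> WP u01 g; case/andP: (u01) => u_0 _; have [Wg _] := WP _ u01.
by rewrite /thresholds !mulr_ge0// ltW.
Qed.

Lemma cost_thresholds W u : feasible_valued W -> 0 <= u <= 1 ->
  cost (trunc (thresholds W u)) <= alpha * u + err.
Proof.
move=> WP u01; apply: cost_trunc; first exact: thresholds_ge0.
case/andP: (u01) => u_0 _; have [_ Ws] := WP _ u01.
rewrite (eq_bigr (fun g => alpha * u * (a g * W u g))).
  by rewrite -mulr_sumr ler_piMr// mulr_ge0// ltW.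
by move=> g _; rewrite mulrCA.
Qed.

(** The truncated thresholds are affordable for [alpha u + err], and [value_lipschitz] brings this
    budget back to [alpha u]. *)
Lemma Gemp_le W u : feasible_valued W -> u0 <= u <= 1 ->
  Gemp W u <= value (alpha * u) + err1.
Proof.
move=> WP /andP[u0u u1].
have u_0 : 0 < u := lt_le_trans u00 u0u.
have u01 : 0 <= u <= 1 by rewrite ltW.
have t0 := thresholds_ge0 WP u01; have t01 := trunc01 t0.
have costP := cost_thresholds WP u01.
have := Ntot0_close t0; have := Ntot1_close t0.
rewrite !ler_distl /Gemp => /andP[_ h1] /andP[_ h0].
have hr : reward (trunc (thresholds W u)) <= value (alpha * u + err).
  exact: reward_le_value.
have au : alpha * u0 <= alpha * u by rewrite ler_pM2l.
have := @value_lipschitz _ _ _ _ _ pi_gt0 pi_sum1 q01 F_ccdf _ (alpha * u)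
  (alpha * u + err) au0 au.
rewrite lerDl => /(_ err0).
rewrite /err1; lra.
Qed.

Lemma Gemp_ge W u : optimal W -> err <= alpha * u0 / 2 -> u0 <= u <= 1 ->
  value (alpha * u) - err1 <= Gemp W u.
Proof.
move=> Wopt err_small /andP[u0u u1].
have e_ge0 := err0; have au0_ := au0.
have u_0 : 0 < u := lt_le_trans u00 u0u.
have au_0 : 0 < alpha * u by rewrite mulr_gt0.
have au : alpha * u0 <= alpha * u by rewrite ler_pM2l.
(* With the budget lowered by [err], the weights [t / (alpha u)] of any affordable [t] meet the
   empirical constraint, so the optimal weights do at least as well. *)
pose s := alpha * u - err.
have s0 : 0 < s by rewrite /s; lra.
have hs : value s <= Gemp W u + 2 * err.
  apply: value_le => //; first exact: ltW.
  move=> t [t01 ts].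
  have t0 g : 0 <= t g by case/andP: (t01 g).
  have tE : trunc t = t.
    by apply/funext => g; rewrite /trunc min_l//; case/andP: (t01 g).
  pose w g := t g / (alpha * u).
  have wP : feasible w.
    split=> [g|]; first by rewrite divr_ge0// ltW.
    rewrite (eq_bigr (fun g => a g * t g / (alpha * u))); last first.
      by move=> g _; rewrite mulrA.
    rewrite -mulr_suml ler_pdivrMr// mul1r.
    apply: (@le_trans _ _ (cost t + err)); last by move: ts; rewrite /s; lra.
    rewrite errE -big_split /=; apply: ler_sum => g _.
    have := closeP.(close_a) g; rewrite ler_distl => /andP[h2 h3].
    have : (a g - pi g) * t g <= e.
      apply: (@le_trans _ _ (e * t g)); first by rewrite ler_wpM2r//; lra.
      by rewrite ler_piMr//; case/andP: (t01 g).
    lra.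
  have := Wopt u _ _ wP; rewrite ltW//= => /(_ u1).
  have -> : Gemp (fun=> w) u = Ntot N0 t + Ntot N1 t.
    rewrite /Gemp (_ : thresholds _ u = t)//; apply/funext => g.
    by rewrite /thresholds /w mulrCA divff ?mulr1// gt_eqF.
  have := Ntot0_close t0; have := Ntot1_close t0.
  rewrite !ler_distl tE => /andP[h1 _] /andP[h0 _]; lra.
have h2s : alpha * u0 / 2 <= s by rewrite /s; lra.
have := @value_star _ _ _ _ _ pi_gt0 pi_sum1 q01 F_ccdf s (alpha * u) s0.
rewrite /s lerBlDr lerDl => /(_ e_ge0); rewrite -/s => hstar.
have v0 : 0 <= value s by apply: value_ge0 => //; exact: ltW.
have v1 : value (alpha * u) <= 1 by apply: value_le1 => //; exact: ltW.
(* As [s] may lie below [alpha u0], the loss is estimated from the ratio inequality [value_star],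
   which gives [err / (alpha u)]. *)
have : value (alpha * u) - value s <= err / (alpha * u0).
  apply: (@le_trans _ _ (err / (alpha * u))); last first.
    by rewrite ler_wpM2l// lef_pV2 ?posrE.
  rewrite ler_pdivlMr// mulrBl.
  have : s * value (alpha * u) <= value s * (alpha * u) by rewrite (mulrC (value s)).
  have : err * value (alpha * u) <= err by rewrite ler_piMr.
  rewrite /s; lra.
rewrite /err1; lra.
Qed.

Lemma crossing_has_sup W : has_sup [set u | 0 <= u <= 1 /\ u <= Gemp W u].
Proof.
split; last by exists 1 => u [/andP[]].
exists 0; rewrite /= lexx ler01; split=> //; rewrite addr_ge0//; apply: sumr_ge0 => g _.
  exact: closeP.(close_N0_ge0).
exact: closeP.(close_N1_ge0).
Qed.

Lemma crossing01 W : 0 <= crossing (Gemp W) <= 1.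
Proof.
have [[x xP] _] := crossing_has_sup W; apply/andP; split.
  have /andP[x0 _] := xP.1; apply: le_trans x0 _.
  by apply: ub_le_sup => //; case: (crossing_has_sup W).
by apply: ge_sup; [exists x|move=> u [/andP[]]].
Qed.

(** A point [u] beyond [us] can satisfy [u <= Gemp W u] only if [c (u - us) <= err1]; optimality
    plays no part in this direction. *)
Lemma crossing_le W : feasible_valued W -> crossing (Gemp W) <= us + err2.
Proof.
move=> WP; have e2 := err20; apply: ge_sup; first by case: (crossing_has_sup W).
move=> u [/andP[u_0 u1] hu].
have [uus|usu] := leP u us; first by lra.
have uP : us <= u <= 1 by rewrite ltW.
have u0u : u0 <= u <= 1 by rewrite (le_trans (ltW u0us))// ltW.
have := Gemp_le WP u0u; have := value_right uP => h1 h2.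
have : (u - us) * c <= err1 by lra.
rewrite -ler_pdivlMr// -/err2; lra.
Qed.

(** The point [us - err2] itself satisfies the crossing condition: [value] exceeds the diagonal
    there by [c err2 = err1], which absorbs the error in [Gemp_ge]. The bound on [err2] keeps this
    point in the range of [value_left]. *)
Lemma crossing_ge W : optimal W -> err <= alpha * u0 / 2 -> err2 <= us - u0 ->
  us - err2 <= crossing (Gemp W).
Proof.
move=> Wopt err_small err2_small; have e2 := err20; have h1 := us1; have h2 := u00.
apply: ub_le_sup; first by case: (crossing_has_sup W).
split; first by lra.
have uP : u0 <= us - err2 <= us by lra.
have uP1 : u0 <= us - err2 <= 1 by lra.
have := Gemp_ge Wopt err_small uP1; have := value_left uP.
have -> : c * (us - (us - err2)) = err1.
  by rewrite /err2 mulrC; field; rewrite gt_eqF.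
lra.
Qed.

(** The sum of the errors in [Gemp_crossing] and [null_crossing]. *)
Definition err3 : R := 3 * err1 + 6 * err + err2 + err2 / u0.

(** * Rejection counts at the empirical crossing point *)

Section at_crossing.
Variable W : R -> 'I_G -> R.
Hypothesis WP : feasible_valued W.
Variable u : R.
Hypothesis uE : u = crossing (Gemp W).
Local Notation t := (thresholds W u).

Let crossing_itv : 0 <= u <= 1. Proof. by rewrite uE crossing01. Qed.
Let le_crossing : u <= us + err2. Proof. by rewrite uE crossing_le. Qed.

Lemma power_le : Ntot N1 t <= (1 - q * alpha) * us + 2 * err + (err2 + err) / (alpha * u0).
Proof.
have u01 : 0 <= u <= 1 := crossing_itv.
have t0 := thresholds_ge0 WP u01; have t01 := trunc01 t0.
have e_0 := err0; have e2_0 := err20.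
have := Ntot1_close t0; rewrite ler_distl => /andP[_ h1].
have hc : cost (trunc t) <= alpha * us + (err2 + err).
  have := cost_thresholds WP u01.
  have : alpha * u <= alpha * us + err2.
    have h := le_crossing.
    have : alpha * u <= alpha * (us + err2) by rewrite ler_pM2l.
    have : alpha * err2 <= err2 by rewrite ler_piMl// ltW.
    lra.
  lra.
pose s := cost (trunc t).
have s0 : 0 <= s.
  by apply: sumr_ge0 => g _; rewrite mulr_ge0 ?(ltW (pi_gt0 g))//; case/andP: (t01 g).
have s1 : s <= 1.
  rewrite -pi_sum1; apply: ler_sum => g _; rewrite ler_piMr ?(ltW (pi_gt0 g))//.
  by case/andP: (t01 g).
have hr : reward (trunc t) <= value s by exact: reward_le_value.
have aus1 : alpha * us <= 1 by rewrite mulr_ile1 ?ltW.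
have auus : alpha * u0 <= alpha * us by rewrite ler_pM2l// ltW.
have hE : 0 <= (err2 + err) / (alpha * u0) by apply: divr_ge0; [exact: addr_ge0|exact: ltW].
rewrite -/s in h1 hc.
(* Up to [alpha us], [value s - q s] is at most its value at [alpha us]. Beyond, the excess cost is
   at most [err2 + err] and the Lipschitz bound applies. *)
have [su|us_] := leP s (alpha * us).
  have := @value_slope _ _ _ _ _ pi_gt0 pi_sum1 q01 F_ccdf _ _ s0 su aus1.
  rewrite value_us; lra.
have := @value_lipschitz _ _ _ _ _ pi_gt0 pi_sum1 q01 F_ccdf _ _ _ au0 auus (ltW us_).
rewrite value_us => h.
have : (s - alpha * us) / (alpha * u0) <= (err2 + err) / (alpha * u0).
  by rewrite ler_pM2r ?invr_gt0//; lra.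
have : q * (alpha * us) <= q * s by rewrite ler_pM2l// ltW.
lra.
Qed.

Hypothesis Wopt : optimal W.
Hypothesis err_small : err <= alpha * u0 / 2.
Hypothesis err2_small : err2 <= us - u0.

(** [Gemp W u] is within [err1] of [value (alpha u)], which is close to [value (alpha us) = us]
    because [u] is within [err2] of [us]. *)
Lemma Gemp_crossing : `|Gemp W u - us| <= err1 + err2 / u0.
Proof.
have := crossing_ge Wopt err_small err2_small; rewrite -uE; have := le_crossing.
have /andP[u_0 u1] : 0 <= u <= 1 := crossing_itv.
move=> hle hge; have e2_0 := err20; have e1_0 := err10; have e2s := err2_small.
have u0u : u0 <= u by lra.
have uP : u0 <= u <= 1 by rewrite u0u.
have := Gemp_le WP uP; have := Gemp_ge Wopt err_small uP.
suff : `|value (alpha * u) - us| <= err2 / u0.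
  by rewrite !ler_distl => /andP[? ?] ? ?; apply/andP; split; lra.
have lip x y : u0 <= x -> x <= y -> value (alpha * y) <= value (alpha * x) + (y - x) / u0.
  move=> u0x xy; have x0 := lt_le_trans u00 u0x.
  have := @value_lipschitz _ _ _ _ _ pi_gt0 pi_sum1 q01 F_ccdf
    (alpha * u0) (alpha * x) (alpha * y) au0.
  rewrite !ler_pM2l// => /(_ u0x xy).
  by rewrite -mulrBr -mulf_div divff ?mul1r// gt_eqF.
have lip2 x y : y - x <= err2 -> (y - x) / u0 <= err2 / u0.
  by move=> ?; rewrite ler_pM2r// invr_gt0.
rewrite -{1}value_us.
have nd x y : 0 <= x -> x <= y -> value (alpha * x) <= value (alpha * y).
  move=> x0 xy; apply: value_nd => //; first by rewrite mulr_ge0// ltW.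
  by rewrite ler_pM2l.
have e2u : 0 <= err2 / u0 by rewrite divr_ge0// ltW.
have [uus|usu] := leP u us; rewrite ler_distl; apply/andP; split.
- have := lip _ _ u0u uus; have : us - u <= err2 by lra.
  by move/lip2; lra.
- have := nd _ _ u_0 uus; lra.
- have := nd _ _ (ltW us0) (ltW usu); lra.
- have := lip _ _ (ltW u0us) (ltW usu); have : u - us <= err2 by lra.
  by move/lip2; lra.
Qed.

(** Null counts follow the cost of the thresholds, which optimality forces close to [alpha u], and
    [u] is within [err2] of [us]. *)
Lemma null_crossing : `|Ntot N0 t - q * alpha * us| <= 2 * err1 + 6 * err + err2.
Proof.
have u01 : 0 <= u <= 1 := crossing_itv.
have t0 := thresholds_ge0 WP u01; have t01 := trunc01 t0.
have e_0 := err0; have e2_0 := err20; have e1_0 := err10.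
have := crossing_ge Wopt err_small err2_small; rewrite -uE; have := le_crossing.
move=> hle hge; have e2s := err2_small.
have u0u : u0 <= u by lra.
have uP : u0 <= u <= 1 by case/andP: u01 => _ ->; rewrite u0u.
have hG := Gemp_ge Wopt err_small uP.
have hc := cost_thresholds WP u01.
have := Ntot0_close t0; have := Ntot1_close t0; rewrite !ler_distl.
move=> /andP[h1 h1'] /andP[h0 h0'].
have hGE : Gemp W u = Ntot N0 t + Ntot N1 t by [].
set s := cost (trunc t) in h1 h1' h0 h0' hc *.
have s0 : 0 <= s.
  by apply: sumr_ge0 => g _; rewrite mulr_ge0 ?(ltW (pi_gt0 g))//; case/andP: (t01 g).
have hr : reward (trunc t) <= value s by exact: reward_le_value.
have au1 : alpha * u <= 1 by case/andP: u01 => *; rewrite mulr_ile1// ltW.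
(* [Gemp W u] is at least [value (alpha u) - err1] and at most [value s + 2 err]; the slope [q] of
   [value] turns this gap into a bound on the unspent budget. *)
have hlow : q * (alpha * u - s) <= err1 + 2 * err.
  have [su|us_] := leP s (alpha * u).
    have := @value_slope _ _ _ _ _ pi_gt0 pi_sum1 q01 F_ccdf _ _ s0 su au1; lra.
  have : q * (alpha * u) <= q * s by rewrite ler_pM2l// ltW.
  lra.
have hup : q * (s - alpha * u) <= err.
  have : q * (s - alpha * u) <= q * err by rewrite ler_pM2l//; lra.
  have : q * err <= err by rewrite ler_piMl// ltW.
  lra.
have qa0 : 0 < q * alpha by rewrite mulr_gt0.
have qa1 : q * alpha <= 1 by rewrite mulr_ile1 ?ltW.
have : `|q * alpha * (u - us)| <= err2.
  rewrite normrM gtr0_norm//; apply: (@le_trans _ _ `|u - us|).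
    by rewrite ler_piMl.
  by rewrite ler_distl; apply/andP; split; lra.
rewrite ler_norml => /andP[? ?].
by apply/andP; split; lra.
Qed.

(** Alternative rejections are all rejections minus the null ones, close to [us - q alpha us]. *)
Lemma power_crossing : `|Ntot N1 t - (1 - q * alpha) * us| <= err3.
Proof.
have := null_crossing; have := Gemp_crossing; rewrite !ler_distl.
have e_0 := err0; have e1_0 := err10.
have -> : Gemp W u = Ntot N0 t + Ntot N1 t by [].
by rewrite /err3 => /andP[? ?] /andP[? ?]; apply/andP; split; lra.
Qed.

End at_crossing.

End fixed_error.
End empirical_problem.

(** All error terms are linear in [e]. The limit [us] is fixed before [delta], and [e] serves all
    weight functions at once. *)
Lemma threshold_limit {R : realType} {G : nat} (pi : 'I_G -> R)
    (F : 'I_G -> R -> R) (q alpha u0 : R) :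
  (forall g, 0 < pi g) -> \sum_g pi g = 1 -> 0 < q < 1 ->
  (forall g, concave_cdf (F g)) -> 0 < alpha < 1 ->
  0 < u0 <= 1 -> u0 < value pi F q (alpha * u0) ->
  exists2 us, 0 < us < 1 & forall delta, 0 < delta ->
  exists2 e, 0 < e & forall a N0 N1, uclose pi F q e a N0 N1 ->
  forall W, feasible_valued a W ->
  let t := thresholds alpha W (crossing (Gemp N0 N1 alpha W)) in
  Ntot N1 t <= (1 - q * alpha) * us + delta /\
  (optimal a N0 N1 alpha W ->
    `|Ntot N0 t - q * alpha * us| <= delta /\
    `|Ntot N1 t - (1 - q * alpha) * us| <= delta).
Proof.
move=> pi_gt0 pi_sum1 q01 F_ccdf alpha01 u01 u0_value.
have [us [c [c0 us_lt value_us value_right value_left]]] :=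
  value_crossing pi_gt0 pi_sum1 q01 F_ccdf alpha01 u01 u0_value.
have [u00 _] := andP u01; have [u0us us1] := andP us_lt.
have us0 : 0 < us by lra.
exists us; [by rewrite us0|move=> delta delta0].
have K0 : 0 < G%:R :> R.
  rewrite ltr0n lt0n; apply/eqP => G0; move: pi_sum1; rewrite big1.
    by move/esym/eqP; rewrite oner_eq0.
  by case=> g gP; exfalso; move: gP; rewrite G0.
have au0 : 0 < alpha * u0 by rewrite mulr_gt0//; lra.
(* [k] is the factor from [err] to [err1]; [T] collects the coefficients of [err] in all the final
   bounds. *)
pose k : R := 2 + (alpha * u0)^-1.
have k0 : 0 < k by rewrite addr_gt0// invr_gt0.
pose T : R := 3 * k + 6 + k / c + k / c / u0 + (k / c + 1) / (alpha * u0).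
have kc0 : 0 < k / c by rewrite divr_gt0.
have kcu0 : 0 < k / c / u0 by rewrite divr_gt0.
have kca0 : 0 < (k / c + 1) / (alpha * u0) by rewrite divr_gt0// addr_gt0.
have T0 : 0 < T by rewrite /T; lra.
(* [x] is the intended value of [err]: its three bounds give the two smallness conditions of the
   crossing lemmas and the accuracy [delta]. *)
pose x : R := Num.min (alpha * u0 / 2) (Num.min ((us - u0) / (k / c)) (delta / T)).
have x0 : 0 < x.
  rewrite /x !lt_min !divr_gt0//; lra.
have x1 : x <= alpha * u0 / 2 by rewrite /x ge_min lexx.
have x2 : x * (k / c) <= us - u0.
  by rewrite -ler_pdivlMr// /x ge_min ge_min lexx orbT.
have x3 : x * T <= delta by rewrite -ler_pdivlMr// /x !ge_min lexx !orbT.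
exists (x / G%:R); first by rewrite divr_gt0.
move=> a N0 N1 closeP W WP t.
have e0 : 0 <= x / G%:R by rewrite divr_ge0// ltW.
have errE : @err R G (x / G%:R) = x by rewrite /err mulrC divfK// gt_eqF.
have err1E : @err1 R G (x / G%:R) alpha u0 = x * k.
  by rewrite /err1 errE /k mulrDr (mulrC 2).
have err2E : @err2 R G (x / G%:R) alpha u0 c = x * (k / c).
  by rewrite /err2 err1E mulrA.
have err3E : @err3 R G (x / G%:R) alpha u0 c = x * (3 * k + 6 + k / c + k / c / u0).
  by rewrite /err3 err2E err1E errE; ring.
have xTE : x * T = x * (3 * k + 6 + k / c + k / c / u0) + x * ((k / c + 1) / (alpha * u0)).
  by rewrite -mulrDr.
have h1 : 0 <= x * k by rewrite mulr_ge0// ltW.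
have h2 : 0 <= x * (k / c) by rewrite mulr_ge0// ltW.
have h3 : 0 <= x * (k / c / u0) by rewrite mulr_ge0// ltW.
have h4 : 0 <= x * ((k / c + 1) / (alpha * u0)) by rewrite mulr_ge0// ltW.
split.
  have := power_le pi_gt0 pi_sum1 q01 F_ccdf e0 closeP alpha01 u00 us_lt c0
    value_us value_right WP erefl.
  rewrite err2E errE -/t.
  rewrite (_ : (x * (k / c) + x) / _ = x * ((k / c + 1) / (alpha * u0))).
    by lra.
  by rewrite [RHS]mulrA; congr (_ / _); ring.
move=> Wopt.
have es : @err R G (x / G%:R) <= alpha * u0 / 2 by rewrite errE.
have e2s : @err2 R G (x / G%:R) alpha u0 c <= us - u0 by rewrite err2E.
split.
  apply: le_trans (null_crossing pi_gt0 pi_sum1 q01 F_ccdf e0 closeP alpha01 u00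
    us_lt c0 value_right value_left WP erefl Wopt es e2s) _.
  by rewrite err2E err1E errE; lra.
apply: le_trans (power_crossing pi_gt0 pi_sum1 q01 F_ccdf e0 closeP alpha01 u00
    us_lt c0 value_us value_right value_left WP erefl Wopt es e2s) _.
by rewrite err3E; lra.
Qed.

(** * Concave distribution functions *)

Section concave_cdf_theory.
Context {R : realType}.
Implicit Types (f : R -> R) (x y e : R).

(** Concavity against the origin, as in [value_star]: [f x / x] is nonincreasing. *)
Lemma concave_cdf_star f x y : concave_cdf f -> 0 < x -> x <= y -> y <= 1 ->
  x * f y <= y * f x.
Proof.
move=> fP x0 xy y1; have y0 : 0 < y by lra.
have y01 : 0 <= y <= 1 by rewrite ltW.
have z01 : 0 <= (0 : R) <= 1 by rewrite lexx ler01.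
have a01 : 0 <= x / y <= 1 by rewrite divr_ge0 ?(ltW x0) ?(ltW y0)//= ler_pdivrMr// mul1r.
have := @ccv_concave _ _ fP _ _ _ y01 z01 a01.
rewrite fP.(ccv_0) !mulr0 !addr0 divfK ?gt_eqF//.
by rewrite mulrAC ler_pdivrMr// (mulrC (f x)).
Qed.

(** Below a point [z] with [f z <= e] the bound is immediate; beyond [z] increments are at most
    [(y - x) / y], which is less than [(y - x) / z]. *)
Lemma concave_cdf_modulus f e : concave_cdf f -> 0 < e ->
  exists2 d, 0 < d & forall x y, 0 <= x -> x <= y -> y <= 1 -> y - x <= d ->
    f y <= f x + e.
Proof.
move=> fP e0; have [z /andP[z0 z1] fz] := fP.(ccv_rc0) e0.
exists (e * z); first exact: mulr_gt0.
move=> x y x0 xy y1 xyd.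
have [yz|zy] := leP y z.
  have := fP.(ccv_nd) yz; have := concave_cdf_ge0 fP x0; lra.
have y0 : 0 < y by lra.
rewrite -(ler_pM2l y0) mulrDr.
have fy1 := concave_cdf_le1 y fP.
have h1 : (y - x) * f y <= y - x by rewrite ler_piMr//; lra.
have h2 : e * z <= y * e by rewrite mulrC ler_pM2r// ltW.
have [x00|x_0] := ltP 0 x.
  have := concave_cdf_star fP x00 xy y1; lra.
have x00 : x = 0 by apply/eqP; rewrite eq_le x_0.
move: h1 xyd; rewrite x00 fP.(ccv_0) !subr0; lra.
Qed.

(** Between two grid points a monotone [A] is squeezed by its values at them, while [f] varies by at
    most [e] when the mesh is below its modulus of continuity. *)
Lemma concave_cdf_grid f e : concave_cdf f -> 0 < e ->
  exists N : nat, forall A : R -> R, {homo A : x y / x <= y} ->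
    (forall k, (k <= N.+1)%N -> `|A (k%:R / N.+1%:R) - f (k%:R / N.+1%:R)| <= e) ->
    forall x, 0 <= x <= 1 -> `|A x - f x| <= 2 * e.
Proof.
move=> fP e0; have [d d0 fd] := concave_cdf_modulus fP e0.
exists (Num.truncn d^-1) => A And AP x /andP[x0 x1].
set N := (Num.truncn d^-1).+1 in AP *.
have N0 : 0 < N%:R :> R by rewrite ltr0n.
have Nd : N%:R^-1 <= d.
  rewrite -[d]invrK lef_pV2 ?posrE ?invr_gt0//.
  by have /truncn_itv/andP[_ /ltW] : 0 <= d^-1 by rewrite invr_ge0 ltW.
(* The grid cell of [x]; the point 1 is put into the last cell, since the integer part of [x N]
   would be [N] there. *)
have [k [kN kx xk]] : exists k : nat,
    [/\ (k < N)%N, k%:R / N%:R <= x & x <= k.+1%:R / N%:R].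
  have [x_1|x_1] := ltP x 1; last first.
    have -> : x = 1 by apply/eqP; rewrite eq_le x1.
    exists N.-1; split=> //; first by rewrite ler_pdivrMr// mul1r ler_nat.
    by rewrite divff// gt_eqF.
  have xN : 0 <= x * N%:R by rewrite mulr_ge0.
  have /andP[h1 h2] := truncn_itv xN.
  exists (Num.truncn (x * N%:R)); split.
  - by rewrite -(ltr_nat R); apply: le_lt_trans h1 _; rewrite gtr_pMl.
  - by rewrite ler_pdivrMr.
  - by rewrite ler_pdivlMr// ltW.
have := AP _ (ltnW kN); have := AP _ kN; rewrite !ler_distl => /andP[h1 h2] /andP[h3 h4].
have k1 : k.+1%:R / N%:R <= 1 :> R by rewrite ler_pdivrMr// mul1r ler_nat.
have k0 : 0 <= k%:R / N%:R :> R by rewrite divr_ge0.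
have kk : k.+1%:R / N%:R - k%:R / N%:R <= d.
  by rewrite -mulrBl -natrB// subSnn mul1r.
have := fd _ _ k0 (le_trans kx xk) k1 kk.
have := fP.(ccv_nd) kx; have := fP.(ccv_nd) xk.
have := And _ _ kx; have := And _ _ xk.
move=> *; apply/andP; split; lra.
Qed.

Lemma concave_cdf_U : concave_cdf (@U R).
Proof.
have UE x : 0 <= x <= 1 -> U x = x.
  case/andP; rewrite /U le_eqVlt => /predU1P[<- _|x0 x1].
    by rewrite ltxx mul0r.
  by rewrite x0 mul1r min_l.
have U_le0 x : x <= 0 -> U x = 0 by move=> x0; rewrite /U ltNge x0 mul0r.
have U1 x : 1 <= x -> U x = 1.
  by move=> x1; rewrite /U (lt_le_trans ltr01 x1) mul1r min_r.
split=> //.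
- move=> x y xy; have [x0|x0] := leP x 0.
    rewrite (U_le0 _ x0) /U; case: (ltP 0 y) => y0; last by rewrite mul0r.
    by rewrite mul1r le_min ler01 ltW.
  by rewrite /U x0 (lt_le_trans x0 xy) !mul1r le_min ge_min xy ge_min lexx orbT.
- by rewrite U_le0.
- move=> x y t x01 y01 /andP[t0 t1]; rewrite !UE//.
  by move: x01 y01 => /andP[? ?] /andP[? ?]; apply/andP; split; nra.
- move=> e e0; exists (Num.min e 1); first by rewrite lt_min e0 ltr01 ge_min lexx orbT.
  rewrite UE; first by rewrite ge_min lexx.
  by rewrite le_min ltW//= ler01 ge_min lexx orbT.
Qed.

(** Monotonicity and right continuity at 0 come from [f] being a distribution function, the value 1
    beyond 1 from [X <= 1]. *)
Lemma cdf_concave_cdf d (T : measurableType d) (P : probability T R)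
    (X : {RV P >-> R}) f :
  (forall w, 0 <= X w <= 1) -> (forall t, cdf X t = (f t)%:E) -> f 0 = 0 ->
  strictly_concave01 f -> concave_cdf f.
Proof.
move=> X01 Xf f0 f_sc; split=> //.
- by move=> x y xy; rewrite -lee_fin -!Xf; exact: cdf_nondecreasing.
- move=> x x1; apply/EFin_inj; rewrite -Xf /cdf /distribution /pushforward.
  rewrite (_ : _ @^-1` _ = setT) ?probability_setT//.
  apply/seteqP; split=> //= y _ /=; rewrite in_itv/=.
  by case/andP: (X01 y) => _ /le_trans; exact.
- move=> x y t x01 y01 /andP[].
  rewrite le_eqVlt => /predU1P[<- _|t0].
    by rewrite !mul0r subr0 !mul1r !add0r.
  rewrite le_eqVlt => /predU1P[->|t1].
    by rewrite subrr !mul0r !mul1r !addr0.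
  have [->|xy] := eqVneq x y; last by apply/ltW/f_sc => //; rewrite t0.
  by rewrite -!mulrDl addrC subrK !mul1r.
- move=> e e0.
  have : cdf X x @[x --> 0^'+] --> cdf X 0 by exact: cdf_right_continuous.
  rewrite Xf f0 (_ : cdf X = EFin \o f); last by apply/funext.
  move=> /fine_cvgP[_ /cvgr_lt] /(_ e e0) h.
  near (0 : R)^'+ => x.
  have x0 : 0 < x by near: x; exact: nbhs_right_gt.
  have x1 : x <= 1 by near: x; exact: nbhs_right_le.
  exists x; first by rewrite x0.
  apply/ltW; near: x; exact: h.
Unshelve. all: by end_near. Qed.

End concave_cdf_theory.

(** Some admissible [w] makes the sum of [pi g w g] times the slope of [mix g] at 0 exceed
    [1 / alpha]. For small [u] the thresholds [alpha u w g] then earn more than [u]. *)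
Lemma alpha_star_crossing {R : realType} {G : nat} (pi : 'I_G -> R)
    (F : 'I_G -> R -> R) (q alpha : R) :
  (forall g, 0 < pi g) -> \sum_g pi g = 1 -> 0 < q < 1 ->
  (forall g, concave_cdf (F g)) ->
  (alpha_star pi (fun=> q) F < alpha%:E)%E ->
  0 < alpha /\ exists2 u0, 0 < u0 <= 1 & u0 < value pi F q (alpha * u0).
Proof.
move=> pi_gt0 pi_sum1 /andP[q0 q1] F_ccdf.
move=> /ereal_inf_lt[_ [w [w0 w1] <-]].
pose h g x : \bar R := ((F g x - F g 0) / x)%:E.
have hE g x : h g x = (F g x / x)%:E by rewrite /h (F_ccdf g).(ccv_0) subr0.
have h_ge0 g x : 0 < x -> (0 <= h g x)%E.
  by move=> x0; rewrite hE lee_fin divr_ge0 ?(ltW x0)// concave_cdf_ge0// ltW.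
(* The quotients increase as [x] decreases to 0, so the limit in [slope0] exists, possibly [+oo]. *)
have h_cvg g : h g x @[x --> 0^'+] --> slope0 (F g).
  apply: nonincreasing_at_right_is_cvge.
  near=> x => y z /[!in_itv]/= /andP[y0 yx] /andP[z0 zx] yz.
  rewrite !hE lee_fin ler_pdivrMr// mulrAC ler_pdivlMr//.
  rewrite (mulrC (F g z)) (mulrC (F g y)).
  apply: concave_cdf_star => //; apply: le_trans (ltW zx) _.
  by near: x; exact: nbhs_right_le.
pose D g x : \bar R := ((pi g * w g)%:E * (q%:E + (1 - q)%:E * h g x))%E.
have D_cvg : (\sum_g D g x)%E @[x --> 0^'+] -->
    (\sum_g ((pi g * w g)%:E * (q%:E + (1 - q)%:E * slope0 (F g))))%E.
  apply: cvg_nnesum => g _.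
    near=> x; rewrite /D mule_ge0//.
      by rewrite lee_fin mulr_ge0// ltW.
    apply: adde_ge0; first by rewrite lee_fin ltW.
    apply: mule_ge0; first by rewrite lee_fin subr_ge0 ltW.
    by apply: h_ge0; near: x; exact: nbhs_right_gt.
  apply: cvgeZl => //; apply: cvgeD => //; first exact: cvg_cst.
  exact: cvgeZl.
set S := (\sum_g _)%E => Salpha.
have S0 : (0 <= S)%E.
  apply: sume_ge0 => g _; rewrite mule_ge0//.
    by rewrite lee_fin mulr_ge0// ltW.
  apply: adde_ge0; first by rewrite lee_fin ltW.
  apply: mule_ge0; first by rewrite lee_fin subr_ge0 ltW.
  apply: (cvge_ge _ (h_cvg g)); near=> x; apply: h_ge0.
  by near: x; exact: nbhs_right_gt.
have alpha0 : 0 < alpha.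
  by rewrite -lte_fin; apply: le_lt_trans Salpha; rewrite inve_ge0.
split=> //.
have alphaS : ((alpha^-1)%:E < S)%E.
  move: Salpha; rewrite inve_plt ?inE//= ?lee_fin ?(ltW alpha0)//.
  by rewrite inver gt_eqF.
have : \forall x \near (0 : R)^'+, ((alpha^-1)%:E < \sum_g D g x)%E.
  exact: D_cvg (open_ereal_gt' alphaS).
move=> hx.
near (0 : R)^'+ => x.
have x0 : 0 < x by near: x; exact: nbhs_right_gt.
have x1 : x <= 1 by near: x; exact: nbhs_right_le.
have : ((alpha^-1)%:E < \sum_g D g x)%E by near: x.
have -> : (\sum_g D g x)%E = (\sum_g pi g * w g * (mix F q g x / x))%:E.
  rewrite -sumEFin; apply: eq_bigr => g _; rewrite /D hE.
  transitivity (pi g * w g * (q + (1 - q) * (F g x / x)))%:E => //.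
  by congr EFin; rewrite /mix; field; rewrite gt_eqF.
rewrite lte_fin => hsum.
(* By concavity the quotients only increase below [x], so it suffices to scale
   [w] until all thresholds are at most [x]. *)
pose B : R := \sum_g w g + 1.
have wB g : w g <= B.
  by rewrite /B (bigD1 g)//= -addrA lerDl addr_ge0// sumr_ge0.
have B0 : 0 < B by rewrite ltr_wpDl// sumr_ge0.
pose u0 : R := Num.min 1 (x / (alpha * B)).
have u00 : 0 < u0 by rewrite lt_min ltr01 divr_gt0// mulr_gt0.
have u01 : u0 <= 1 by rewrite ge_min lexx.
have au0 : 0 < alpha * u0 by rewrite mulr_gt0.
have u0x g : alpha * u0 * w g <= x.
  apply: (@le_trans _ _ (alpha * u0 * B)); first by rewrite ler_pM2l.
  by rewrite mulrAC mulrC -ler_pdivlMr ?mulr_gt0// ge_min lexx orbT.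
have t0 g : 0 <= alpha * u0 * w g by rewrite mulr_ge0// ltW.
exists u0; first by rewrite u00.
have q01 : 0 < q < 1 by rewrite q0.
apply: (@lt_le_trans _ _ (reward pi F q (fun g => alpha * u0 * w g))); last first.
  apply: reward_le_value => //; split=> [g|].
    by rewrite t0/=; exact: le_trans (u0x g) x1.
  rewrite /cost (eq_bigr (fun g => alpha * u0 * (pi g * w g))).
    by rewrite -mulr_sumr ler_piMr// ltW.
  by move=> g _; rewrite mulrCA.
apply: (@lt_le_trans _ _ (alpha * u0 * (\sum_g pi g * w g * (mix F q g x / x)))).
  rewrite mulrAC -mulrC -[X in X < _]mulr1 ltr_pM2l//.
  by rewrite mulrC -ltr_pdivrMr// mul1r.
rewrite mulr_sumr; apply: ler_sum => g _.
have -> : alpha * u0 * (pi g * w g * (mix F q g x / x)) =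
  pi g * (alpha * u0 * w g * mix F q g x / x) by rewrite !mulrA; congr (_ / _); ring.
rewrite ler_pM2l// ler_pdivrMr//.
move: (alpha * u0 * w g) (t0 g) (u0x g) => t; rewrite le_eqVlt => /predU1P[<- _|t_0 tx].
  by rewrite mul0r /mix (F_ccdf g).(ccv_0) !mulr0 addr0 mul0r.
rewrite /mix; have := concave_cdf_star (F_ccdf g) t_0 tx x1.
move=> hs; have : (1 - q) * (t * F g x) <= (1 - q) * (x * F g t).
  by rewrite ler_pM2l// subr_gt0.
lra.
Unshelve. all: by end_near. Qed.

(** * Expectations off events of vanishing probability *)

Section exceptional_event.
Context {d : measure_display} {T : measurableType d} {R : realType}.
Context {P : probability T R} {X : T -> R} {B : set T} {r : R}.
Hypothesis X_meas : measurable_fun setT X.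
Hypothesis B_meas : measurable B.
Hypothesis X01 : forall x, 0 <= X x <= 1.

Let X_ge0 x : 0 <= X x. Proof. by case/andP: (X01 x). Qed.
Let X_le1 x : X x <= 1. Proof. by case/andP: (X01 x). Qed.

Let indicB_ge0 x : 0 <= \1_B x :> R. Proof. by rewrite indicE. Qed.

(** Pointwise [X <= r + \1_B], since [X <= 1] on [B]. *)
Lemma expectation_le_off : 0 <= r -> (forall x, ~ B x -> X x <= r) ->
  ('E_P[X] <= r%:E + P B)%E.
Proof.
move=> r0 Xr.
apply: (@le_trans _ _ (\int[P]_x (r%:E + (\1_B x)%:E))%E); last first.
  rewrite ge0_integralD//=.
  - by rewrite integral_cst//= probability_setT mule1 integral_indic// setIT.
  - exact/measurable_EFinP/measurable_indic.
rewrite unlock; apply: ge0_le_integral => //=.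
- by move=> x _; rewrite lee_fin.
- exact/measurable_EFinP.
- by apply: emeasurable_funD => //; exact/measurable_EFinP/measurable_indic.
- move=> x _; rewrite -EFinD lee_fin; have [Bx|/Xr Xxr] := pselect (B x).
    by rewrite indicE mem_set// (le_trans (X_le1 x))// lerDr.
  by rewrite (le_trans Xxr)// lerDl.
Qed.

Lemma expectation_ge_off : r <= 1 -> (forall x, ~ B x -> r <= X x) ->
  (r%:E <= 'E_P[X] + P B)%E.
Proof.
move=> r1 rX.
have E0 : (0 <= 'E_P[X])%E by exact: expectation_ge0.
(* A negative [r] is immediate; the comparison of integrals below is between nonnegative
   functions. *)
have [r0|r0] := leP 0 r; last first.
  by rewrite (@le_trans _ _ 0%E) ?adde_ge0// lee_fin ltW.
have -> : ('E_P[X] + P B = \int[P]_x ((X x)%:E + (\1_B x)%:E))%E.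
  rewrite ge0_integralD//=.
  - by rewrite unlock integral_indic// setIT.
  - by move=> x _; rewrite lee_fin.
  - exact/measurable_EFinP.
  - exact/measurable_EFinP/measurable_indic.
have -> : r%:E = (\int[P]_x r%:E)%E by rewrite integral_cst//= probability_setT mule1.
apply: ge0_le_integral => //=.
- by apply: emeasurable_funD; apply/measurable_EFinP => //; exact: measurable_indic.
- move=> x _; rewrite -EFinD lee_fin; have [Bx|/rX rXx] := pselect (B x).
    by rewrite indicE mem_set// (le_trans r1)// lerDr.
  by rewrite (le_trans rXx)// lerDl.
Qed.

End exceptional_event.

Section expectation_limits.
Context {R : realType} (d : nat -> measure_display).
Context (T : forall m, measurableType (d m)) (P : forall m, probability (T m) R).
Implicit Types (X : forall m, T m -> R) (B : forall m, set (T m)) (e l : R).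

Definition negligible_in_limit B : Prop :=
  (forall m, measurable (B m)) /\ P m (B m) @[m --> \oo] --> 0%E.

Lemma negligible_in_limit_le B e : negligible_in_limit B -> 0 < e ->
  \forall m \near \oo, (P m (B m) <= e%:E)%E.
Proof.
move=> [Bm /fine_cvgP[_ Bc]] e0; have Be := cvgr_le _ Bc _ e0.
near=> m; have Pfin : P m (B m) \is a fin_num by exact: fin_num_measure.
by rewrite -(fineK Pfin) lee_fin; near: m; exact: Be.
Unshelve. all: by end_near. Qed.

Lemma negligible_in_limit_bigU (I : Type) (s : seq I) (B : I -> forall m, set (T m)) :
  (forall i, negligible_in_limit (B i)) ->
  negligible_in_limit (fun m => \big[setU/set0]_(i <- s) B i m).
Proof.
move=> BP; elim: s => [|i s [IHm IHc]].
  split=> [m|]; first by rewrite big_nil.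
  rewrite (_ : (fun m => _) = cst 0%E); first exact: cvg_cst.
  by apply/funext => m; rewrite big_nil measure0.
have [Bm Bc] := BP i.
split=> [m|]; first by rewrite big_cons; exact: measurableU.
apply: (@squeeze_cvge _ _ _ _ (cst 0%E) _
  (fun m => P m (B i m) + P m (\big[setU/set0]_(i <- s) B i m))%E).
- by apply: nearW => m /=; rewrite measure_ge0/= big_cons measureU2.
- exact: cvg_cst.
- by rewrite -[0%E]adde0; apply: cvgeD.
Qed.

(** Conditions are put on large [m] only, because measurability of the procedures is assumed for
    [m > 0]. *)
Lemma limn_esup_expectation_le X (u : nat -> \bar R) l : 0 <= l ->
  (\forall m \near \oo, u m = ('E_(P m)[X m])%E) ->
  (\forall m \near \oo, measurable_fun setT (X m) /\ forall x, 0 <= X m x <= 1) ->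
  (forall e, 0 < e -> exists2 B, negligible_in_limit B &
     \forall m \near \oo, forall x, ~ B m x -> X m x <= l + e) ->
  (limn_esup u <= l%:E)%E.
Proof.
move=> l0 uE Xreg XB; apply/lee_addgt0Pr => e e0.
have e20 : 0 < e / 2 by rewrite divr_gt0.
have [B Bneg Bl] := XB _ e20.
have Ble := negligible_in_limit_le Bneg e20.
have [N _ hN] : \forall m \near \oo, (u m <= l%:E + e%:E)%E.
  near=> m; have -> : u m = ('E_(P m)[X m])%E by near: m.
  have [Xm X01] : measurable_fun setT (X m) /\ forall x, 0 <= X m x <= 1 by near: m.
  have BX : forall x, ~ B m x -> X m x <= l + e / 2 by near: m.
  have le0 : 0 <= l + e / 2 by lra.
  apply: le_trans (expectation_le_off Xm (Bneg.1 m) X01 le0 BX) _.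
  have : (P m (B m) <= (e / 2)%:E)%E by near: m.
  move=> /(leeD2l (l + e / 2)%:E)/le_trans; apply.
  by rewrite -!EFinD lee_fin -addrA -splitr.
(* The upper limit is at most the supremum over the tail from [N] on. *)
apply: ge_ereal_inf; exists (ereal_sup [set u m | m in [set m | (N <= m)%N]]).
  by exists [set m | (N <= m)%N] => //; exists N.
by apply: ge_ereal_sup => _ [m /= Nm <-]; exact: hN.
Unshelve. all: by end_near. Qed.

Lemma cvg_expectation X l : 0 <= l <= 1 ->
  (\forall m \near \oo, measurable_fun setT (X m) /\ forall x, 0 <= X m x <= 1) ->
  (forall e, 0 < e -> exists2 B, negligible_in_limit B &
     \forall m \near \oo, forall x, ~ B m x -> `|X m x - l| <= e) ->
  ('E_(P m)[X m])%E @[m --> \oo] --> l%:E.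
Proof.
move=> /andP[l0 l1] Xreg XB.
have bounds e : 0 < e -> \forall m \near \oo,
    ((l - e)%:E <= 'E_(P m)[X m] <= (l + e)%:E)%E.
  move=> e0; have e20 : 0 < e / 2 by rewrite divr_gt0.
  have [B Bneg Bl] := XB _ e20.
  have Ble := negligible_in_limit_le Bneg e20.
  near=> m.
  have [Xm X01] : measurable_fun setT (X m) /\ forall x, 0 <= X m x <= 1 by near: m.
  have BX : forall x, ~ B m x -> `|X m x - l| <= e / 2 by near: m.
  have PB : (P m (B m) <= (e / 2)%:E)%E by near: m.
  apply/andP; split.
    have h x : ~ B m x -> l - e / 2 <= X m x.
      by move=> /BX; rewrite ler_distl => /andP[].
    have le1 : l - e / 2 <= 1 by lra.
    have := expectation_ge_off (P := P m) Xm (Bneg.1 m) X01 le1 h.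
    move=> /le_trans/(_ (leeD2l _ PB)); rewrite -leeBlDr//.
    by rewrite -EFinB -addrA -opprD -splitr.
  have h x : ~ B m x -> X m x <= l + e / 2.
    by move=> /BX; rewrite ler_distl => /andP[].
  have le0 : 0 <= l + e / 2 by lra.
  apply: le_trans (expectation_le_off Xm (Bneg.1 m) X01 le0 h) _.
  apply: le_trans (leeD2l _ PB) _.
  by rewrite -!EFinD lee_fin -addrA -splitr.
(* Convergence to a finite limit goes through [fine], which requires eventually finite expectations;
   the bounds with error 1 give this. *)
have finE : \forall m \near \oo, ('E_(P m)[X m])%E \is a fin_num.
  near=> m; have : ((l - 1)%:E <= 'E_(P m)[X m] <= (l + 1)%:E)%E.
    by near: m; exact: bounds.
  by move/andP=> [h1 h2]; rewrite fin_numE; apply/andP; split;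
    apply/eqP => hE; move: h1 h2; rewrite hE.
apply/fine_cvgP; split=> //; apply/cvgrPdist_le => e e0.
near=> m; have /= := near finE m; rewrite distrC ler_distl -!lee_fin => Efin.
rewrite fineK; last by near: m.
by near: m; exact: bounds.
Unshelve. all: by end_near. Qed.

End expectation_limits.

(** * Counting rejections *)

Section random_sets.
Context {R : realType} {G : nat} {n : 'I_G -> nat}.

(** There are finitely many sets of indices, so a preimage is a finite union of events [S x = B],
    each a finite intersection of membership events or their complements. *)
Lemma measurable_random_set d (T : measurableType d) (S : T -> {set hyp n})
    (g : {set hyp n} -> R) :
  random_set S -> measurable_fun setT (fun x => g (S x)).
Proof.
move=> rS _ Y mY; rewrite setTI.
rewrite (_ : _ @^-1` Y = \bigcup_(B in [set B | Y (g B)]) [set x | S x = B]); last first.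
  by apply/seteqP; split=> [x Yx|x [B /= YB ->]//]; exists (S x).
apply: fin_bigcup_measurable => [|B _]; first exact: finite_finset.
rewrite (_ : [set x | _] =
    \bigcap_(k in [set: hyp n]) [set x | (k \in S x) = (k \in B)]); last first.
  apply/seteqP; split=> [x SB k _|x Bx]; first by rewrite /= SB.
  by apply/setP => k; exact: Bx.
apply: fin_bigcap_measurable => [|k _]; first exact: finite_finset.
case: (k \in B); first exact: rS.
rewrite (_ : [set x | _] = ~` [set x | k \in S x]); first exact/measurableC/rS.
by apply/seteqP; split=> x /= => [->//|/negP/negbTE].
Qed.

(** It makes the empirical distribution functions measurable, as functions of this random set. *)
Lemma random_level_set d (T : measurableType d) (P : probability T R)
    (p : forall g, 'I_(n g) -> {RV P >-> R}) (t : R) :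
  random_set (fun x => finset (fun k : hyp n => p (tag k) (tagged k) x <= t)).
Proof.
move=> k; rewrite (_ : [set x | _] = p (tag k) (tagged k) @^-1` `]-oo, t]).
  by rewrite -[X in measurable X]setTI; exact: measurable_funP.
apply/seteqP; split=> x /=; first by rewrite inE in_itv.
by rewrite in_itv/= => px; rewrite inE.
Qed.

End random_sets.

(** * From p-values to normalized counts *)

Section empirical_counts.
Context {R : realType} {G m : nat} {n : 'I_G -> nat}.
Hypothesis m_gt0 : (0 < m)%N.
Hypothesis n_sum : (\sum_(g < G) n g)%N = m.
Unset Implicit Arguments.
Context (H : forall g : 'I_G, 'I_(n g) -> bool) (p : forall g, 'I_(n g) -> R).
Set Implicit Arguments.
Hypothesis p01 : forall g i, 0 <= p g i <= 1.

Definition null_frac (g : 'I_G) (t : R) : R :=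
  m%:R^-1 * \sum_(i < n g) ((p g i <= t) && ~~ H g i)%:R.
Definition alt_frac (g : 'I_G) (t : R) : R :=
  m%:R^-1 * \sum_(i < n g) ((p g i <= t) && H g i)%:R.

Lemma num_alt_null (g : 'I_G) : (num_null H g + num_alt H g)%N = n g.
Proof.
rewrite /num_null subnK// /num_alt -[leqRHS]card_ord -sum1_card.
by apply: leq_sum => i _; case: (H g i).
Qed.

Lemma num_nullE (g : 'I_G) : num_null H g = (\sum_(i < n g) ~~ H g i)%N.
Proof.
apply/eqP; rewrite -(eqn_add2r (num_alt H g)) num_alt_null /num_alt -big_split /=.
by rewrite -[X in X == _]card_ord -sum1_card; apply/eqP/eq_bigr => i _; case: (H g i).
Qed.

Lemma null_fracE g t :
  null_frac g t = (num_null H g)%:R / m%:R * emp_null H p g t.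
Proof.
(* Without nulls in the group the inverse in [emp_null] takes its default value, and both sides
   vanish. *)
rewrite /null_frac /emp_null; have [n0|n0] := eqVneq (num_null H g) 0%N.
  apply/eqP; rewrite n0 !mul0r mulf_eq0; apply/orP; right; apply/eqP.
  apply: big1 => i _; move/eqP: n0; rewrite num_nullE sum_nat_eq0 => /forallP/(_ i).
  by rewrite eqb0 => /negbTE ->; rewrite andbF.
by rewrite mulrA; congr (_ * _); rewrite mulrAC divff ?mul1r// pnatr_eq0.
Qed.

Lemma alt_fracE g t :
  alt_frac g t = (num_alt H g)%:R / m%:R * emp_alt H p g t.
Proof.
rewrite /alt_frac /emp_alt; have [n0|n0] := eqVneq (num_alt H g) 0%N.
  apply/eqP; rewrite n0 !mul0r mulf_eq0; apply/orP; right; apply/eqP.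
  apply: big1 => i _; move/eqP: n0; rewrite sum_nat_eq0 => /forallP/(_ i).
  by rewrite eqb0 => /negbTE ->; rewrite andbF.
by rewrite mulrA; congr (_ * _); rewrite mulrAC divff ?mul1r// pnatr_eq0.
Qed.

Lemma emp_null_nd g : {homo emp_null H p g : x y / x <= y}.
Proof.
move=> x y xy; rewrite /emp_null ler_wpM2l ?invr_ge0//; apply: ler_sum => i _.
rewrite ler_nat; case: (H g i); rewrite ?andbF//= !andbT.
by case: (leP (p g i) x) => // px; rewrite (le_trans px xy).
Qed.

Lemma emp_alt_nd g : {homo emp_alt H p g : x y / x <= y}.
Proof.
move=> x y xy; rewrite /emp_alt ler_wpM2l ?invr_ge0//; apply: ler_sum => i _.
rewrite ler_nat; case: (H g i); rewrite ?andbF//= !andbT.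
by case: (leP (p g i) x) => // px; rewrite (le_trans px xy).
Qed.

Lemma le_min1 g i t : (p g i <= Num.min t 1) = (p g i <= t).
Proof. by rewrite le_min; case/andP: (p01 i) => _ ->; rewrite andbT. Qed.

(** Each normalized count is a proportion, known within [e], times an empirical distribution
    function, known within [2 e]; factors in [0,1] make the product correct within [3 e]. *)
Lemma uclose_frac (pi : 'I_G -> R) (F : 'I_G -> R -> R) (q e : R) :
  (forall g, concave_cdf (F g)) -> 0 < e ->
  (forall g, `|(n g)%:R / m%:R - pi g| <= e) ->
  (forall g, `|(num_null H g)%:R / m%:R - pi g * q| <= e) ->
  (forall g, `|(num_alt H g)%:R / m%:R - pi g * (1 - q)| <= e) ->
  (forall g x, 0 <= x <= 1 -> `|emp_null H p g x - U x| <= 2 * e) ->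
  (forall g x, 0 <= x <= 1 -> `|emp_alt H p g x - F g x| <= 2 * e) ->
  uclose pi F q (3 * e) (fun g => (n g)%:R / m%:R) null_frac alt_frac.
Proof.
move=> F_ccdf e0 ha h0 h1 hU hF.
have prod_close (x x0 y y0 : R) : 0 <= x <= 1 -> 0 <= y0 <= 1 ->
    `|x - x0| <= e -> `|y - y0| <= 2 * e -> `|x * y - x0 * y0| <= 3 * e.
  move=> /andP[x_0 x_1] /andP[y00 y01] hx hy.
  have -> : x * y - x0 * y0 = x * (y - y0) + (x - x0) * y0 by ring.
  apply: le_trans (ler_normD _ _) _; rewrite !normrM (ger0_norm x_0) (ger0_norm y00).
  have : x * `|y - y0| <= `|y - y0| by rewrite ler_piMl.
  have : `|x - x0| * y0 <= `|x - x0| by rewrite ler_piMr.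
  lra.
have n_le g : (n g <= m)%N by rewrite -n_sum (bigD1 g)//= leq_addr.
have frac01 k g : (k <= n g)%N -> 0 <= (k%:R / m%:R : R) <= 1.
  move=> kn; rewrite divr_ge0//= ler_pdivrMr ?ltr0n// mul1r ler_nat.
  exact: leq_trans kn (n_le g).
split.
- by move=> g; apply: le_trans (ha g) _; lra.
- move=> g x x01; rewrite null_fracE [pi g * _]mulrA.
  have Ux : U x = x.
    case/andP: x01; rewrite /U le_eqVlt => /predU1P[<- _|x0 x1].
      by rewrite ltxx mul0r.
    by rewrite x0 mul1r min_l.
  apply: prod_close => //; last by rewrite -{2}Ux; exact: hU.
  by apply: (frac01 _ g); rewrite -(num_alt_null g) leq_addr.
- move=> g x x01; rewrite alt_fracE [pi g * _]mulrA; apply: prod_close; last exact: hF.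
  + by apply: (frac01 _ g); rewrite -(num_alt_null g) leq_addl.
  + case/andP: x01 => x0 _.
    by rewrite concave_cdf_ge0//= concave_cdf_le1.
  + exact: h1.
- by move=> g; rewrite divr_ge0.
- by move=> g x; rewrite mulr_ge0 ?invr_ge0// sumr_ge0.
- by move=> g x; rewrite mulr_ge0 ?invr_ge0// sumr_ge0.
- by move=> g x; rewrite /null_frac; under eq_bigr do rewrite le_min1.
- by move=> g x; rewrite /alt_frac; under eq_bigr do rewrite le_min1.
Qed.

Lemma GhatE alpha W : Ghat m alpha p W = Gemp null_frac alt_frac alpha W.
Proof.
apply/funext => u; rewrite /Ghat /Gemp /Ntot -big_split mulr_sumr /=.
apply: eq_bigr => g _; rewrite /null_frac /alt_frac -mulrDr -big_split /=.
congr (_ * _); apply: eq_bigr => i _; rewrite /thresholds.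
by case: (_ <= _); case: (H g i); rewrite ?addr0 ?add0r.
Qed.

Lemma card_MWBH_nulls alpha W :
  #|MWBH m alpha p W :&: nulls H|%:R = m%:R *
    Ntot null_frac (thresholds alpha W (crossing (Gemp null_frac alt_frac alpha W))) :> R.
Proof.
rewrite -GhatE -/(uhat m alpha p W) /Ntot mulr_sumr.
under eq_bigr do rewrite /null_frac mulrA divff ?mul1r ?pnatr_eq0 -?lt0n//.
rewrite -sum1_card natr_sum (@sig_big_dep _ _ _ _ _ xpredT (fun _ => xpredT)) /= big_mkcond /=.
apply: eq_bigr => k _; rewrite !inE /thresholds.
by case: (_ && _).
Qed.

Lemma card_MWBH_alts alpha W :
  #|MWBH m alpha p W :&: alts H|%:R = m%:R *
    Ntot alt_frac (thresholds alpha W (crossing (Gemp null_frac alt_frac alpha W))) :> R.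
Proof.
rewrite -GhatE -/(uhat m alpha p W) /Ntot mulr_sumr.
under eq_bigr do rewrite /alt_frac mulrA divff ?mul1r ?pnatr_eq0 -?lt0n//.
rewrite -sum1_card natr_sum (@sig_big_dep _ _ _ _ _ xpredT (fun _ => xpredT)) /= big_mkcond /=.
apply: eq_bigr => k _; rewrite !inE /thresholds.
by case: (_ && _).
Qed.

Lemma card_nulls_alts (S : {set hyp n}) :
  (#|S :&: nulls H| + #|S :&: alts H|)%N = #|S|.
Proof.
rewrite -(cardsID (nulls H) S); congr (_ + _)%N; apply: eq_card => k.
by rewrite !inE negbK andbC.
Qed.

Lemma card_hyp (S : {set hyp n}) : (#|S| <= m)%N.
Proof.
apply: leq_trans (max_card _) _.
rewrite card_tagged sumnE big_map big_enum /= -n_sum.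
by apply/eq_leq/eq_bigr => g _; rewrite card_ord.
Qed.

End empirical_counts.

(** * Asymptotics of the procedures *)

(** The numerator [x - a (x + y)] is at most [3 e] in absolute value, and [x + y >= s / 2]. *)
Lemma ratio_close {R : realFieldType} (a s x y e : R) : 0 < a < 1 -> 0 < s ->
  4 * e <= s -> `|x - a * s| <= e -> `|y - (1 - a) * s| <= e ->
  `|x / (x + y) - a| <= 6 * e / s.
Proof.
move=> /andP[a0 a1] s0 es; rewrite !ler_distl => /andP[x1 x2] /andP[y1 y2].
have e0 : 0 <= e by lra.
have xy : s / 2 <= x + y by lra.
have xy0 : 0 < x + y by lra.
have ae : a * (2 * e) <= 2 * e by rewrite ler_piMl//; lra.
have axy1 : a * (x + y) <= a * (s + 2 * e) by rewrite ler_pM2l//; lra.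
have axy2 : a * (s - 2 * e) <= a * (x + y) by rewrite ler_pM2l//; lra.
have key : 3 * e <= 6 * e / s * (x + y).
  apply: (@le_trans _ _ (6 * e / s * (s / 2))); last first.
    by rewrite ler_wpM2l// divr_ge0 ?(ltW s0)// mulr_ge0.
  by rewrite le_eqVlt; apply/orP; left; apply/eqP; field; rewrite gt_eqF.
by apply/andP; split; [rewrite ler_pdivlMr|rewrite ler_pdivrMr]; lra.
Qed.

(** * Uniform convergence in probability of empirical distribution functions *)

Section glivenko_cantelli.
Context {R : realType} (d : nat -> measure_display).
Context (T : forall m, measurableType (d m)) (P : forall m, probability (T m) R).

Lemma cvg_in_prob_negligible (X : forall m, T m -> R) (l e : R) :
  (forall m, measurable_fun setT (X m)) -> cvg_in_prob P X l -> 0 < e ->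
  negligible_in_limit P (fun m => [set x | e < `|X m x - l|]).
Proof.
move=> mX Xl e0; split=> [m|]; last exact: Xl.
rewrite (_ : [set x | _] = (fun x => `|X m x - l|) @^-1` `]e, +oo[).
  rewrite -[X in measurable X]setTI.
  have : measurable_fun setT (fun x => `|X m x - l|).
    by apply: measurableT_comp => //; apply: measurable_funB.
  by apply.
by apply/seteqP; split=> x /=; rewrite in_itv/= andbT.
Qed.

Lemma uniform_in_prob (A : forall m, T m -> R -> R) (f : R -> R) (e : R) :
  concave_cdf f -> (forall m x, {homo A m x : s t / s <= t}) ->
  (forall m t, measurable_fun setT (A m ^~ t)) ->
  (forall t, 0 <= t -> cvg_in_prob P (fun m x => A m x t) (f t)) -> 0 < e ->
  exists2 B, negligible_in_limit P B & forall m x, ~ B m x ->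
    forall t, 0 <= t <= 1 -> `|A m x t - f t| <= 2 * e.
Proof.
move=> fP And mA Af e0; have [N hN] := concave_cdf_grid fP e0.
pose bad k m := [set x | e < `|A m x (k%:R / N.+1%:R) - f (k%:R / N.+1%:R)|].
exists (fun m => \big[setU/set0]_(k <- iota 0 N.+2) bad k m).
  apply: negligible_in_limit_bigU => k; apply: cvg_in_prob_negligible => //.
  by apply: Af; rewrite divr_ge0.
move=> m x Bx; apply: hN => [|k kN]; first exact: And.
rewrite leNgt; apply/negP => badk; apply: Bx.
have kI : k \in iota 0 N.+2 by rewrite mem_iota.
by rewrite -bigcup_seq; exists k.
Qed.

End glivenko_cantelli.

(** * Limits of the false discovery rate and of the power *)

Section assembly.
Context {R : realType} {G : nat} (d : nat -> measure_display).
Context (T : forall m, measurableType (d m)) (P : forall m, probability (T m) R).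
Unset Implicit Arguments.
Context (n : nat -> 'I_G -> nat) (H : forall m (g : 'I_G), 'I_(n m g) -> bool).
Context (p : forall m (g : 'I_G), 'I_(n m g) -> {RV (P m) >-> R}).
Set Implicit Arguments.
Hypothesis n_sum : forall m, (\sum_(g < G) n m g)%N = m.
Hypothesis p01 : forall m g i x, 0 <= p m g i x <= 1.
Context (F : 'I_G -> R -> R) (pi : 'I_G -> R) (q alpha : R).
Hypothesis pi_gt0 : forall g, 0 < pi g.
Hypothesis pi_sum1 : \sum_g pi g = 1.
Hypothesis q01 : 0 < q < 1.
Hypothesis alpha01 : 0 < alpha < 1.
Hypothesis F_ccdf : forall g, concave_cdf (F g).
Hypothesis cvg_pi : forall g, (n m g)%:R / m%:R @[m --> \oo] --> pi g.
Hypothesis cvg_null : forall g,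
  (num_null (H m) g)%:R / m%:R @[m --> \oo] --> pi g * q.
Hypothesis cvg_alt : forall g,
  (num_alt (H m) g)%:R / m%:R @[m --> \oo] --> pi g * (1 - q).
Hypothesis weak_dep_null : forall g (t : R), 0 <= t ->
  cvg_in_prob P (fun m x => emp_null (H m) (fun g i => p m g i x) g t) (U t).
Hypothesis weak_dep_alt : forall g (t : R), 0 <= t ->
  cvg_in_prob P (fun m x => emp_alt (H m) (fun g i => p m g i x) g t) (F g t).

Local Notation pv m x := (fun g i => p m g i x).

Lemma measurable_emp_null m g t :
  measurable_fun setT (fun x => emp_null (H m) (pv m x) g t).
Proof.
pose f (S : {set hyp (n m)}) : R := (num_null (H m) g)%:R^-1 *
  \sum_(i < n m g) ((Tagged (fun g => 'I_(n m g)) i \in S) && ~~ H m g i)%:R.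
have := measurable_random_set f (random_level_set (p m) t).
apply: eq_measurable_fun => x _; rewrite /f /emp_null; congr (_ * _).
by apply: eq_bigr => i _; rewrite inE.
Qed.

Lemma measurable_emp_alt m g t :
  measurable_fun setT (fun x => emp_alt (H m) (pv m x) g t).
Proof.
pose f (S : {set hyp (n m)}) : R := (num_alt (H m) g)%:R^-1 *
  \sum_(i < n m g) ((Tagged (fun g => 'I_(n m g)) i \in S) && H m g i)%:R.
have := measurable_random_set f (random_level_set (p m) t).
apply: eq_measurable_fun => x _; rewrite /f /emp_alt; congr (_ * _).
by apply: eq_bigr => i _; rewrite inE.
Qed.

(** A union bound over the groups and the two kinds of hypotheses, valid whatever the dependence
    between groups; the proportions converge deterministically. *)
Lemma uclose_in_prob e : 0 < e ->
  exists2 B, negligible_in_limit P B & \forall m \near \oo,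
    forall x, ~ B m x -> uclose pi F q (3 * e) (fun g => (n m g)%:R / m%:R)
      (null_frac (m := m) (H m) (pv m x)) (alt_frac (m := m) (H m) (pv m x)).
Proof.
move=> e0.
have /choice[B0 B0P] : forall g, exists B, negligible_in_limit P B /\
    forall m x, ~ B m x -> forall t, 0 <= t <= 1 ->
      `|emp_null (H m) (pv m x) g t - U t| <= 2 * e.
  move=> g.
  have [B Bneg BP] := uniform_in_prob concave_cdf_U
    (fun m x => @emp_null_nd _ _ _ (H m) (pv m x) g)
    (fun m t => @measurable_emp_null m g t) (weak_dep_null g) e0.
  by exists B.
have /choice[B1 B1P] : forall g, exists B, negligible_in_limit P B /\
    forall m x, ~ B m x -> forall t, 0 <= t <= 1 ->
      `|emp_alt (H m) (pv m x) g t - F g t| <= 2 * e.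
  move=> g.
  have [B Bneg BP] := uniform_in_prob (F_ccdf g)
    (fun m x => @emp_alt_nd _ _ _ (H m) (pv m x) g)
    (fun m t => @measurable_emp_alt m g t) (weak_dep_alt g) e0.
  by exists B.
pose B (i : bool * 'I_G) := if i.1 then B0 i.2 else B1 i.2.
exists (fun m => \big[setU/set0]_(i <- index_enum (bool * 'I_G)%type) B i m).
  apply: negligible_in_limit_bigU => -[[] g].
    by have [] := B0P g.
  by have [] := B1P g.
have near_all (u : nat -> 'I_G -> R) (l : 'I_G -> R) :
    (forall g, u m g @[m --> \oo] --> l g) ->
    \forall m \near \oo, forall g, `|u m g - l g| <= e.
  move=> ul; apply: filter_forall => g.
  by near=> m; rewrite distrC; near: m; move/cvgrPdist_le : (ul g); exact.
near=> m => x nBx.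
have m0 : (0 < m)%N by near: m; exact: nbhs_infty_gt.
have nB i : ~ B i m x.
  by move=> Bi; apply: nBx; rewrite -bigcup_seq; exists i => //=; rewrite mem_index_enum.
apply: (uclose_frac m0 (n_sum m) (p := pv m x)) => //.
- by near: m; exact: near_all.
- by near: m; exact: near_all.
- by near: m; exact: near_all.
- by move=> g t; have [_ ] := B0P g; apply; exact: (nB (true, g)).
- by move=> g t; have [_ ] := B1P g; apply; exact: (nB (false, g)).
Unshelve. all: by end_near. Qed.

Context (u0 : R).
Hypothesis u01 : 0 < u0 <= 1.
Hypothesis u0_value : u0 < value pi F q (alpha * u0).

(** The exceptional event concerns the empirical distribution functions alone, so one [B] serves
    every weight function, even a data-dependent one. *)
Lemma rejections_in_prob : exists2 us : R, 0 < us < 1 & forall e, 0 < e ->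
  exists2 B, negligible_in_limit P B & forall W : forall m, T m -> R -> 'I_G -> R,
    (forall m x, (0 < m)%N -> KNE_valued m (n m) (W m x)) ->
    \forall m \near \oo, forall x, ~ B m x ->
    let S := MWBH m alpha (pv m x) (W m x) in
    #|S :&: alts (H m)|%:R / m%:R <= (1 - q * alpha) * us + e /\
    (Ghat_optimal m alpha (pv m x) (W m x) ->
      `|#|S :&: nulls (H m)|%:R / m%:R - q * alpha * us| <= e /\
      `|#|S :&: alts (H m)|%:R / m%:R - (1 - q * alpha) * us| <= e).
Proof.
have [us us01 Hus] := threshold_limit pi_gt0 pi_sum1 q01 F_ccdf alpha01 u01 u0_value.
exists us => // e e0; have [e' e'0 He'] := Hus _ e0.
have e3 : 0 < e' / 3 by rewrite divr_gt0.
have [B Bneg HB] := uclose_in_prob e3.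
exists B => // W WP; near=> m => x nBx.
have m0 : (0 < m)%N by near: m; exact: nbhs_infty_gt.
have : uclose pi F q (3 * (e' / 3)) (fun g => (n m g)%:R / m%:R)
    (null_frac (m := m) (H m) (pv m x)) (alt_frac (m := m) (H m) (pv m x)).
  by move: x nBx; near: m.
rewrite mulrC divfK ?pnatr_eq0// => cl.
have [Hle Hopt] := He' _ _ _ cl _ (WP m x m0).
rewrite (card_MWBH_alts m0) (card_MWBH_nulls m0) !(mulrC m%:R).
rewrite !mulfK ?pnatr_eq0 -?lt0n//; split=> // Wopt; apply: Hopt.
move=> u uP w wP; have := Wopt u uP w wP.
by rewrite !(GhatE (H m)).
Unshelve. all: by end_near. Qed.

Definition fdp m (S : {set hyp (n m)}) : R :=
  #|S :&: nulls (H m)|%:R / (maxn #|S| 1)%:R.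
Definition power_frac m (S : {set hyp (n m)}) : R :=
  m%:R^-1 * #|S :&: alts (H m)|%:R.

Lemma fdp01 m (S : {set hyp (n m)}) : 0 <= fdp S <= 1.
Proof.
rewrite divr_ge0//= ler_pdivrMr ?ltr0n ?leq_max ?orbT// mul1r ler_nat leq_max.
by rewrite subset_leq_card// finset.subsetIl.
Qed.

Lemma power_frac01 m (S : {set hyp (n m)}) : 0 <= power_frac S <= 1.
Proof.
rewrite /power_frac mulr_ge0 ?invr_ge0//= mulrC; case: (posnP m) => m0.
  have -> : m%:R^-1 = 0 :> R by rewrite m0 invr0.
  by rewrite mulr0.
rewrite ler_pdivrMr ?ltr0n// mul1r ler_nat.
exact: card_hyp.
Qed.

Lemma PowE m (S : T m -> {set hyp (n m)}) : random_set S ->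
  (Pow m (H m) (P m) S = 'E_(P m)[fun x => power_frac (S x)])%E.
Proof.
move=> rS; rewrite /Pow unlock -ge0_integralZl//=.
- apply/measurable_EFinP.
  exact: (measurable_random_set (fun B => #|B :&: alts (H m)|%:R) rS).
Qed.

Lemma MWBH_limits : exists2 us : R, 0 < us &
  (forall W : forall m, T m -> R -> 'I_G -> R,
    (forall m x, (0 < m)%N -> KNE_valued m (n m) (W m x)) ->
    (forall m, (0 < m)%N -> random_set (fun x => MWBH m alpha (pv m x) (W m x))) ->
    (limn_esup (fun m => Pow m (H m) (P m) (fun x => MWBH m alpha (pv m x) (W m x)))
      <= ((1 - q * alpha) * us)%:E)%E /\
    ((forall m x, (0 < m)%N -> Ghat_optimal m alpha (pv m x) (W m x)) ->
      FDR (H m) (P m) (fun x => MWBH m alpha (pv m x) (W m x)) @[m --> \oo]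
        --> (q * alpha)%:E /\
      Pow m (H m) (P m) (fun x => MWBH m alpha (pv m x) (W m x)) @[m --> \oo]
        --> ((1 - q * alpha) * us)%:E)).
Proof.
have [us /andP[us0 us1] Hus] := rejections_in_prob; exists us => // W WP Wrand.
have [q0 q1] := andP q01; have [a0 a1] := andP alpha01.
have qa : 0 < q * alpha < 1.
  by rewrite mulr_gt0//= (@lt_trans _ _ q)// gtr_pMr.
have l01 : 0 <= (1 - q * alpha) * us <= 1.
  by rewrite mulr_ge0 ?mulr_ile1//; lra.
pose S m x := MWBH m alpha (pv m x) (W m x).
pose power m x := power_frac (S m x).
pose fdp_ m x := fdp (S m x).
have power_reg : \forall m \near \oo,
    measurable_fun setT (power m) /\ forall x, 0 <= power m x <= 1.
  near=> m; split; last by move=> x; exact: power_frac01.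
  apply: (measurable_random_set (@power_frac m)); apply: Wrand.
  by near: m; exact: nbhs_infty_gt.
have fdp_reg : \forall m \near \oo,
    measurable_fun setT (fdp_ m) /\ forall x, 0 <= fdp_ m x <= 1.
  near=> m; split; last by move=> x; exact: fdp01.
  apply: (measurable_random_set (@fdp m)); apply: Wrand.
  by near: m; exact: nbhs_infty_gt.
have power_eq : \forall m \near \oo,
    Pow m (H m) (P m) (S m) = ('E_(P m)[power m])%E.
  near=> m; apply: PowE; apply: Wrand; by near: m; exact: nbhs_infty_gt.
split.
  apply: (limn_esup_expectation_le _ power_eq power_reg) => [|e e0].
    by case/andP: l01.
  have [B Bneg HB] := Hus _ e0; exists B => //.
  apply: filterS (HB _ WP) => m Hm x /Hm[Hle _].
  by rewrite /power /power_frac mulrC.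
move=> Wopt; split.
  apply: (@cvg_expectation _ _ _ P fdp_) => //.
    by case/andP: qa => qa0 qa1; rewrite !ltW.
  move=> e e0.
  (* The first bound is the smallness condition of [ratio_close], the second makes its error
     [6 e' / us] at most [e]. *)
  pose e' := Num.min (us / 4) (e * us / 6).
  have e'0 : 0 < e' by rewrite lt_min !divr_gt0// mulr_gt0.
  have [B Bneg HB] := Hus _ e'0; exists B => //.
  apply: filterS2 (HB _ WP) (nbhs_infty_gt 0) => m Hm m0 x.
  move=> /Hm[_ /(_ (Wopt m x m0))[h0 h1]].
  have es : 4 * e' <= us by rewrite mulrC -ler_pdivlMr// ge_min lexx.
  have := ratio_close qa us0 es h0 h1.
  rewrite -mulrDl -natrD card_nulls_alts -/(S m x).
  have mR : m%:R != 0 :> R by rewrite pnatr_eq0 -lt0n.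
  rewrite -mulf_div divff ?mulr1 ?invr_eq0// => h.
  (* With no rejections the quotient [0 / 0] is 0, in agreement with [0 / 1]. *)
  have -> : fdp_ m x = #|S m x :&: nulls (H m)|%:R / #|S m x|%:R.
    rewrite /fdp_ /fdp; have [S0|S0] := posnP #|S m x|; last by rewrite (maxn_idPl S0).
    have -> : #|S m x :&: nulls (H m)| = 0%N.
      by apply/eqP; rewrite -leqn0 -S0 subset_leq_card// finset.subsetIl.
    by rewrite !mul0r.
  apply: le_trans h _; rewrite ler_pdivrMr// mulrC -ler_pdivlMr//.
  by rewrite ge_min lexx orbT.
apply: cvg_trans (@cvg_expectation _ _ _ P power _ l01 power_reg _).
  by apply: near_eq_cvg; near=> m; apply/esym; near: m; exact: power_eq.
move=> e e0; have [B Bneg HB] := Hus _ e0; exists B => //.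
apply: filterS2 (HB _ WP) (nbhs_infty_gt 0) => m Hm m0 x.
move=> /Hm[_ /(_ (Wopt m x m0))[_ h1]].
by rewrite /power /power_frac mulrC.
Unshelve. all: by end_near. Qed.

End assembly.

Theorem corollary5p1 (R : realType) (G : nat) (G_ge2 : (2 <= G)%N)
  (d : nat -> measure_display) (T : forall m, measurableType (d m))
  (P : forall m, probability (T m) R)
  (n : nat -> 'I_G -> nat)
  (n_nondecreasing : forall g m1 m2, (m1 <= m2)%N -> (n m1 g <= n m2 g)%N)
  (n_sum : forall m, (\sum_(g < G) n m g)%N = m)
  (H : forall m (g : 'I_G), 'I_(n m g) -> bool)
  (p : forall m (g : 'I_G), 'I_(n m g) -> {RV (P m) >-> R})
  (p01 : forall m g i x, 0 <= p m g i x <= 1)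
  (F : 'I_G -> R -> R) (pi pi0 : 'I_G -> R) (alpha : R)
  (null_uniform : forall m g i, H m g i = false ->
    forall A : set R, measurable A ->
      distribution (P m) (p m g i) A = uniform_prob (@ltr01 R) A)
  (alt_cdf : forall m g i, H m g i = true ->
    forall t : R, cdf (p m g i) t = (F g t)%:E)
  (F_strictly_concave : forall g, strictly_concave01 (F g))
  (F_0 : forall g, F g 0 = 0)
  (pi_gt0 : forall g, 0 < pi g)
  (pi0_gt0 : forall g, 0 < pi0 g)
  (pi1_gt0 : forall g, 0 < 1 - pi0 g)
  (cvg_pi : forall g, (n m g)%:R / m%:R @[m --> \oo] --> pi g)
  (cvg_pi0 : forall g,
    (num_null (H m) g)%:R / (n m g)%:R @[m --> \oo] --> pi0 g)
  (weak_dep_null : forall g (t : R), 0 <= t ->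
    cvg_in_prob P
      (fun m x => emp_null (H m) (fun g i => p m g i x) g t) (U t))
  (weak_dep_alt : forall g (t : R), 0 <= t ->
    cvg_in_prob P
      (fun m x => emp_alt (H m) (fun g i => p m g i x) g t) (F g t))
  (alpha_gt : (alpha_star pi pi0 F < alpha%:E)%E)
  (alpha_lt1 : alpha < 1)
  (evenly_distributed : forall g, pi0 g = \sum_(g' < G) pi g' * pi0 g')
  (WNE : forall m, T m -> R -> 'I_G -> R)
  (WNE_KNE : forall m x, (0 < m)%N -> KNE_valued m (n m) (WNE m x))
  (WNE_opt : forall m x, (0 < m)%N ->
    Ghat_optimal m alpha (fun g i => p m g i x) (WNE m x))
  (WNE_random : forall m, (0 < m)%N ->
    random_set (fun x => MWBH m alpha (fun g i => p m g i x) (WNE m x))) :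
  let IHW m (x : T m) := MWBH m alpha (fun g i => p m g i x) (WNE m x) in
  FDR (H m) (P m) (IHW m) @[m --> \oo]
    --> ((\sum_(g < G) pi g * pi0 g) * alpha)%:E
  /\ cvgn (fun m => Pow m (H m) (P m) (IHW m))
  /\ (forall W : forall m, T m -> R -> 'I_G -> R,
      (forall m x, (0 < m)%N -> KNE_valued m (n m) (W m x)) ->
      (forall m x, (0 < m)%N ->
        Ghat_nondecreasing m alpha (fun g i => p m g i x) (W m x)) ->
      (forall m, (0 < m)%N ->
        random_set (fun x => MWBH m alpha (fun g i => p m g i x) (W m x))) ->
      (limn_esup (fun m => Pow m (H m) (P m)
         (fun x => MWBH m alpha (fun g i => p m g i x) (W m x)))
       <= limn (fun m => Pow m (H m) (P m) (IHW m)))%E).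

Proof.
move=> IHW.
pose q : R := \sum_(g < G) pi g * pi0 g.
have g0 : 'I_G := Ordinal (ltnW G_ge2).
have q01 : 0 < q < 1.
  by rewrite /q -(evenly_distributed g0) pi0_gt0/= -subr_gt0 pi1_gt0.
(* The proportions [n m g / m] sum to 1 for [m > 0], and limits are unique. *)
have pi_sum1 : \sum_g pi g = 1.
  have sum_cvg : \sum_g (n m g)%:R / m%:R @[m --> \oo] --> \sum_g pi g.
    by apply: cvg_big => [|g _]; [exact: add_continuous|exact: cvg_pi].
  apply: (cvg_unique _ sum_cvg) => //.
  apply: cvg_near_cst.
  near=> m; rewrite -mulr_suml -natr_sum n_sum divff// pnatr_eq0 -lt0n.
  by near: m; exact: nbhs_infty_gt.
have n_gt0 g : \forall m \near \oo, (0 < n m g)%N.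
  near=> m; rewrite lt0n; apply/eqP => n0.
  have : 0 < (n m g)%:R / m%:R :> R.
    near: m; exact: (cvgr_gt _ (cvg_pi g) _ (pi_gt0 g)).
  by rewrite n0 mul0r ltxx.
have cvg_null g : (num_null (H m) g)%:R / m%:R @[m --> \oo] --> pi g * q.
  rewrite /q -(evenly_distributed g) mulrC.
  apply: cvg_trans (cvgM (cvg_pi0 g) (cvg_pi g)).
  apply: near_eq_cvg; near=> m => /=.
  rewrite mulrA divfK// pnatr_eq0 -lt0n.
  by near: m; exact: n_gt0.
have cvg_alt g : (num_alt (H m) g)%:R / m%:R @[m --> \oo] --> pi g * (1 - q).
  rewrite mulrBr mulr1; apply: cvg_trans (cvgB (cvg_pi g) (cvg_null g)).
  apply: near_eq_cvg; near=> m => /=.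
  by rewrite !fctE -mulrBl -(num_alt_null (H m) g) natrD addrC addKr.
(* The limiting share of alternatives in group [g] is positive, so for some [m] there is an
   alternative p-value, and [F g] is its distribution function. *)
have F_ccdf g : concave_cdf (F g).
  have [m [i Hi]] : exists m i, H m g i = true.
    have [m] : exists m, (0 < num_alt (H m) g)%N.
      near \oo => m; exists m; rewrite lt0n; apply/eqP => a0.
      have : 0 < (num_alt (H m) g)%:R / m%:R :> R.
        near: m; apply: (cvgr_gt _ (cvg_alt g)).
        by rewrite mulr_gt0// subr_gt0; case/andP: q01.
      by rewrite a0 mul0r ltxx.
    by rewrite lt0n /num_alt sum_nat_eq0 => /forallPn[i]; rewrite eqb0 negbK => Hi; exists m, i.
  exact: (cdf_concave_cdf (p01 m g i) (alt_cdf m g i Hi)).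
have [alpha0 [u0 u01 u0_value]] : 0 < alpha /\
    exists2 u0, 0 < u0 <= 1 & u0 < value pi F q (alpha * u0).
  apply: alpha_star_crossing => //.
  by rewrite (_ : (fun=> q) = pi0)//; apply/funext => g; exact: esym (evenly_distributed g).
have alpha01 : 0 < alpha < 1 by rewrite alpha0.
have [us us0 lims] := MWBH_limits n_sum p01 pi_gt0 pi_sum1 q01 alpha01 F_ccdf cvg_pi
  cvg_null cvg_alt weak_dep_null weak_dep_alt u01 u0_value.
have [_ /(_ WNE_opt)[fdr_cvg pow_cvg]] := lims WNE WNE_KNE WNE_random.
split=> //; split; first exact: cvgP pow_cvg.
(* The limiting power of IHW is exactly the upper bound that [lims] gives for any weight
   function. *)
move=> W WP _ Wrand; rewrite (cvg_lim _ pow_cvg)//.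
exact: (lims W WP Wrand).1.
Unshelve. all: by end_near. Qed.
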